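(* (Strong dual error bound.) Under the assumptions in the context, let $\{(x^t,y^t,z^t)\}$ be generated by the Smoothed Proximal ALM. There exist constants $\delta>0$ and $\sigma_s>0$ (not depending on $t$) such that for every $t\ge0$, if $$\max\left\{\|x^t-x^{t+1}\|,\ \|Ax(y^{t+1},z^t)-b\|,\ \|z^t-x^{t+1}\|\right\}\le\delta,$$ then $$\|x(y^{t+1},z^t)-x(z^t)\|\le\sigma_s\|Ax(y^{t+1},z^t)-b\|.$$
   Context: **Problem.** Minimize $f(x)$ subject to $Ax=b$, $x\in\mathcal X$, where $A\in\mathbb R^{m\times n}$, $b\in\mathbb R^m$, $f:\mathbb R^n\to\mathbb R$ is smooth (possibly nonconvex), and $\mathcal X=\{x\in\mathbb R^n: h_i(x)\le 0,\ i=m+1,\dots,m+\ell\}$ with $h_i:\mathbb R^n\to\mathbb R$. Norms are Euclidean. **Basic assumptions.** (1) $\mathcal X$ is a compact convex set. (2) $f$ is bounded from below on $\mathcal X$. (3) $\|\nabla f(x)-\nabla f(x')\|\le L_f\|x-x'\|$ for all $x,x'\in\mathcal X$. (4) Each $h_i$ is smooth and convex with $L_h$-Lipschitz-continuous gradient. (5) Slater condition: there is $x$ with $Ax=b$ and $h_i(x)<0$ for all $i\in\{m+1,\dots,m+\ell\}$. **Stationary set.** With $\iota$ the indicator function of $\mathcal X$, $\mathcal X^*$ is the set of $x\in\mathcal X$ with $Ax=b$ and $0\in\nabla f(x)+A^Ty+\partial\iota(x)$ for some $y\in\mathbb R^m$. **Constant rank constraint qualification (CRCQ).** Let $Q(x)\in\mathbb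 R^{(m+\ell)\times n}$ be the matrix whose first $m$ rows are the rows of $A$ and whose row $i$ is $\nabla h_i(x)^T$ for $i=m+1,\dots,m+\ell$. For $x\in\mathcal X$ let $\mathcal S_x=\{1,\dots,m\}\cup\{i\in\{m+1,\dots,m+\ell\}:h_i(x)=0\}$, and let $Q_{\mathcal S}(x)$ be the row submatrix of $Q(x)$ with rows in $\mathcal S$. CRCQ: for every $x^*\in\mathcal X^*$ and every nonempty $\mathcal S\subseteq\mathcal S_{x^*}$, the rank of $Q_{\mathcal S}(x)$ is constant for $x$ in some neighborhood of $x^*$. **Auxiliary functions.** Let $\gamma\ge0$, $p>L_f$ ($p>0$), $K(x,z;y)=f(x)+y^T(Ax-b)+\frac{\gamma}{2}\|Ax-b\|^2+\frac p2\|x-z\|^2$, $x(y,z)=\arg\min_{x\in\mathcal X}K(x,z;y)$, and $x(z)=\arg\min_{x\in\mathcal X,\,Ax=b}\{f(x)+\frac p2\|x-z\|^2\}$. **Algorithm (Smoothed Proximal ALM).** Let $\alpha>0$, $0<\beta\le1$, $c>0$, $x^0,z^0\in\mathcal X$, $y^0\in\mathbb R^m$, and let $\mathcal P_{\mathcal X}$ be Euclidean projection onto $\mathcal X$. For $t=0,1,2,\dots$: $$y^{t+1}=y^t+\alpha(Ax^t-b),\quad x^{t+1}=\mathcal P_{\mathcal X}\big(x^t-c\nabla_xK(x^t,z^t;y^{t+1})\big),\quad z^{t+1}=z^t+\beta(x^{t+1}-z^t).$$ *)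

(* Defs.v *)
From HB Require Import structures.
From mathcomp Require Export all_boot all_order all_algebra.
From mathcomp Require Export all_classical all_reals all_analysis.

Set Implicit Arguments.
Unset Strict Implicit.
Unset Printing Implicit Defensive.

Import Order.TTheory GRing.Theory Num.Theory.
Import numFieldNormedType.Exports.

Local Open Scope classical_set_scope.
Local Open Scope ring_scope.

Section Euclidean.
Context {R : realType} {n : nat}.
Implicit Types (u v x g : 'cV[R]_n) (D : set 'cV[R]_n) (f : 'cV[R]_n -> R).

Definition dot u v : R := \sum_i u i ord0 * v i ord0.

(* The library norm `|x| on matrices is the sup norm; it is used below only
   through the topology, which is the Euclidean one. *)
Definition enorm u : R := Num.sqrt (dot u u).

(* Meaningful where f is differentiable: the coordinates of the gradient are
   the values of the differential on the canonical basis. *)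
Definition grad f x : 'cV[R]_n := \col_i 'd f x (delta_mx i ord0).

(* Smooth is read as continuously differentiable on the whole space. *)
Definition smooth f : Prop :=
  (forall x, differentiable f x) /\ continuous (grad f).

Definition grad_lipschitz_on D (L : R) f : Prop :=
  forall x x', D x -> D x' ->
    enorm (grad f x - grad f x') <= L * enorm (x - x').

Definition is_argmin D f x : Prop := D x /\ forall u, D u -> f x <= f u.

(* A chosen minimizer of f on D, and 0 if there is none. *)
Definition argmin D f : 'cV[R]_n := xget 0 [set x | is_argmin D f x].

Definition proj D v : 'cV[R]_n := argmin D (fun u => enorm (u - v)).

(* The indicator function of convex analysis, not the 0/1-valued \1_D. *)
Definition cvx_indic D x : \bar R := if x \in D then 0%E else +oo%E.

Definition subdiff (phi : 'cV[R]_n -> \bar R) x : set 'cV[R]_n :=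
  [set g | forall u, (phi x + (dot g (u - x))%:E <= phi u)%E].

End Euclidean.

(* The constraint functions h_(m+1), ..., h_(m+l) are indexed by 'I_l. *)
Section Problem.
Context {R : realType} {n m l : nat}.
Variables (A : 'M[R]_(m, n)) (b : 'cV[R]_m) (f : 'cV[R]_n -> R).
Variable (h : 'I_l -> 'cV[R]_n -> R).
Implicit Types (x z : 'cV[R]_n) (y : 'cV[R]_m) (S : {set 'I_(m + l)}).

Definition constr_set : set 'cV[R]_n := [set x | forall i, h i x <= 0].

Definition slater : Prop := exists x, A *m x = b /\ forall i, h i x < 0.

Definition stationary_set : set 'cV[R]_n :=
  [set x | [/\ constr_set x, A *m x = b &
     exists y g, subdiff (cvx_indic constr_set) x g /\
                 0 = grad f x + A^T *m y + g]].

Definition Qmx x : 'M[R]_(m + l, n) :=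
  col_mx A (\matrix_(i < l) (grad (h i) x)^T).

Definition active x : {set 'I_(m + l)} :=
  [set i : 'I_(m + l) | match fintype.split i with
                   | inl _ => true
                   | inr j => h j x == 0
                   end]%SET.

Definition Qsub S x : 'M[R]_(#|S|, n) :=
  rowsub (fun k : 'I_#|S| => enum_val k) (Qmx x).

Definition CRCQ : Prop :=
  forall xs, stationary_set xs ->
  forall S, S != finset.set0 -> S \subset active xs ->
  exists r : nat, \forall x \near xs, \rank (Qsub S x) = r.

Variables (gamma p : R).

Definition Kfun x z y : R :=
  f x + dot y (A *m x - b) + gamma / 2 * enorm (A *m x - b) ^+ 2
      + p / 2 * enorm (x - z) ^+ 2.

Definition x_yz y z : 'cV[R]_n := argmin constr_set (fun x => Kfun x z y).

Definition x_z z : 'cV[R]_n :=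
  argmin (constr_set `&` [set x | A *m x = b])
         (fun x => f x + p / 2 * enorm (x - z) ^+ 2).

Definition spalm (alpha beta c : R)
    (xs : nat -> 'cV[R]_n) (ys : nat -> 'cV[R]_m) (zs : nat -> 'cV[R]_n) : Prop :=
  [/\ constr_set (xs 0%N), constr_set (zs 0%N) &
      forall t : nat,
      [/\ ys t.+1 = ys t + alpha *: (A *m xs t - b),
          xs t.+1 = proj constr_set
            (xs t - c *: grad (fun x => Kfun x (zs t) (ys t.+1)) (xs t)) &
          zs t.+1 = zs t + beta *: (xs t.+1 - zs t)]].

End Problem.

(* Main.v *)
(* The point u = x(y, z) minimizes g = f + p/2 |. - z|^2 over X and {A v = A u},
   whereas w = x(z) minimizes g over X and {A v = b}. So the claim is Lipschitz
   stability of the strongly convex program "minimize g on X and {A v = q}" under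
   a change of the right-hand side q, and y plays no further role.

   By compactness it suffices to argue near each x* in X. The error bound for a
   projected gradient step shows that x^t, z^t and u are close to each other under
   the smallness condition; a limit of such points satisfies the variational
   inequality that characterizes stationarity, so only x* in X^* matters. Slater's
   condition makes the feasible set Lipschitz in q, which gives Hoelder continuity
   of the solution with exponent 1/2. By Farkas' lemma and Caratheodory reduction,
   every solution has a multiplier supported on a set S of active constraints with
   linearly independent gradients. By CRCQ these gradients stay uniformly
   independent around x*, so multipliers with the same support S depend on the
   solution in a Lipschitz way, and strong monotonicity yields the Lipschitz bound
   between any two solutions sharing the support S.

   Finally, subdivide the segment from b to A u into N pieces. Since there are
   finitely many supports, one goes from w to u by at most as many jumps between
   solutions with a common support, plus that many elementary steps, which are
   negligible by Hoelder continuity as N grows. *)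
From HB Require Import structures.
Require Import Defs.
From mathcomp Require Import lra zify.

Set Implicit Arguments.
Unset Strict Implicit.
Unset Printing Implicit Defensive.

Import Order.TTheory GRing.Theory Num.Theory.
Import numFieldNormedType.Exports.

Local Open Scope classical_set_scope.
Local Open Scope ring_scope.

(** * Euclidean inner product and norm on column vectors *)

Section EuclideanTheory.
Context {R : realType}.

Section VectorTheory.
Context {n : nat}.
Implicit Types (u v w : 'cV[R]_n) (a : R).

Lemma dotC u v : dot u v = dot v u.
Proof. by apply: eq_bigr => i _; rewrite mulrC. Qed.

Lemma dotDl u v w : dot (u + v) w = dot u w + dot v w.
Proof. by rewrite -big_split; apply: eq_bigr => i _; rewrite mxE mulrDl. Qed.

Lemma dotZl a u v : dot (a *: u) v = a * dot u v.
Proof. by rewrite mulr_sumr; apply: eq_bigr => i _; rewrite mxE mulrA. Qed.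

Lemma dotDr u v w : dot u (v + w) = dot u v + dot u w.
Proof. by rewrite !(dotC u) dotDl. Qed.

Lemma dotZr a u v : dot u (a *: v) = a * dot u v.
Proof. by rewrite !(dotC u) dotZl. Qed.

Lemma dotNl u v : dot (- u) v = - dot u v.
Proof. by rewrite -scaleN1r dotZl mulN1r. Qed.

Lemma dotNr u v : dot u (- v) = - dot u v.
Proof. by rewrite !(dotC u) dotNl. Qed.

Lemma dotBl u v w : dot (u - v) w = dot u w - dot v w.
Proof. by rewrite dotDl dotNl. Qed.

Lemma dotBr u v w : dot u (v - w) = dot u v - dot u w.
Proof. by rewrite dotDr dotNr. Qed.

Lemma dot0l u : dot 0 u = 0.
Proof. by rewrite -(scale0r u) dotZl mul0r. Qed.

Lemma dot0r u : dot u 0 = 0.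
Proof. by rewrite dotC dot0l. Qed.

Lemma dot_suml (I : Type) (r : seq I) (F : I -> 'cV[R]_n) u :
  dot (\sum_(i <- r) F i) u = \sum_(i <- r) dot (F i) u.
Proof.
by elim: r => [|i r IH]; rewrite ?big_nil ?dot0l// !big_cons dotDl IH.
Qed.

Lemma dot_ge0 u : 0 <= dot u u.
Proof. by apply: sumr_ge0 => i _; rewrite -expr2 sqr_ge0. Qed.

Lemma dot_delta i u : dot (delta_mx i ord0) u = u i ord0.
Proof.
rewrite /dot (bigD1 i)//= !mxE !eqxx mul1r big1 ?addr0// => j /negbTE ji.
by rewrite mxE ji mul0r.
Qed.

Lemma enorm_ge0 u : 0 <= enorm u.
Proof. exact: sqrtr_ge0. Qed.

Lemma enorm_sqr u : enorm u ^+ 2 = dot u u.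
Proof. by rewrite sqr_sqrtr ?dot_ge0. Qed.

Lemma enorm_eq0 u : (enorm u == 0) = (u == 0).
Proof.
apply/idP/idP => [/eqP u0|/eqP ->]; last by rewrite /enorm dot0l sqrtr0.
have /eqP : dot u u = 0 by rewrite -enorm_sqr u0 expr0n.
rewrite psumr_eq0 => [/allP u00|i _]; last by rewrite -expr2 sqr_ge0.
apply/eqP/matrixP => i j; rewrite (ord1 j) mxE.
have := u00 i (mem_index_enum _).
by rewrite mulf_eq0 orbb => /eqP.
Qed.

Lemma enorm0 : enorm (0 : 'cV[R]_n) = 0.
Proof. by apply/eqP; rewrite enorm_eq0. Qed.

Lemma enormZ a u : enorm (a *: u) = `|a| * enorm u.
Proof.
by rewrite /enorm dotZl dotZr mulrA -expr2 sqrtrM ?sqr_ge0// sqrtr_sqr.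
Qed.

Lemma enormN u : enorm (- u) = enorm u.
Proof. by rewrite -scaleN1r enormZ normrN1 mul1r. Qed.

Lemma enormBC u v : enorm (u - v) = enorm (v - u).
Proof. by rewrite -enormN opprB. Qed.

(** Cauchy-Schwarz, by expanding the square of [enorm v *: u - enorm u *: v]. *)
Lemma dot_le_enorm u v : dot u v <= enorm u * enorm v.
Proof.
have [u0|u0] := eqVneq (enorm u) 0.
  by move/eqP: (u0); rewrite enorm_eq0 => /eqP ->; rewrite dot0l enorm0 mul0r.
have [v0|v0] := eqVneq (enorm v) 0.
  by move/eqP: (v0); rewrite enorm_eq0 => /eqP ->; rewrite dot0r enorm0 mulr0.
have uv0 : 0 < enorm u * enorm v by rewrite mulr_gt0// lt_neqAle enorm_ge0 eq_sym ?u0 ?v0.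
have := dot_ge0 (enorm v *: u - enorm u *: v).
rewrite dotBl !dotBr !dotZl !dotZr (dotC v u) -!enorm_sqr => H.
rewrite -(ler_pM2l uv0); nra.
Qed.

Lemma dot_ge_enorm u v : - (enorm u * enorm v) <= dot u v.
Proof. by rewrite lerNl -dotNl -(enormN u) dot_le_enorm. Qed.

Lemma enormD u v : enorm (u + v) <= enorm u + enorm v.
Proof.
rewrite -(ler_pXn2r (ltn0Sn 1)) ?nnegrE ?addr_ge0 ?enorm_ge0//.
rewrite enorm_sqr dotDl !dotDr (dotC v u) -!enorm_sqr.
have := dot_le_enorm u v; nra.
Qed.

Lemma enorm_tri u v w : enorm (u - w) <= enorm (u - v) + enorm (v - w).
Proof. by rewrite -(subrKA v u (-w)) enormD. Qed.

Lemma enorm_sum (I : Type) (r : seq I) (F : I -> 'cV[R]_n) :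
  enorm (\sum_(i <- r) F i) <= \sum_(i <- r) enorm (F i).
Proof.
elim: r => [|i r IH]; first by rewrite !big_nil enorm0.
by rewrite !big_cons (le_trans (enormD _ _))// lerD2l.
Qed.

Lemma coord_le_enorm u i : `|u i ord0| <= enorm u.
Proof.
have d1 : enorm (delta_mx i ord0 : 'cV[R]_n) = 1.
  by rewrite /enorm dot_delta !mxE !eqxx sqrtr1.
rewrite ler_norml -!(dot_delta i u).
have := dot_ge_enorm (delta_mx i ord0) u; have := dot_le_enorm (delta_mx i ord0) u.
by rewrite d1 mul1r => -> ->.
Qed.

Lemma mx_norm_le_enorm u : `|u| <= enorm u.
Proof.
rewrite /Num.norm/= mx_normrE; apply/bigmax_leP; split; first exact: enorm_ge0.
by move=> [i j] _ /=; rewrite (ord1 j) coord_le_enorm.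
Qed.

Lemma enorm_le_sum u : enorm u <= \sum_i `|u i ord0|.
Proof.
have {1}-> : u = \sum_i u i ord0 *: delta_mx i ord0.
  by rewrite {1}[u]matrix_sum_delta; apply: eq_bigr => i _; rewrite big_ord1.
apply: le_trans (enorm_sum _ _) _; apply: ler_sum => i _.
by rewrite enormZ /enorm dot_delta !mxE !eqxx sqrtr1 mulr1.
Qed.

(** The library balls are sup-norm balls; each contains the Euclidean ball of the same radius. *)
Lemma near_enorm (P : set 'cV[R]_n) u :
  (\forall v \near u, P v) ->
  exists2 e : R, 0 < e & forall v, enorm (v - u) < e -> P v.
Proof.
move=> /nbhs_ballP[e /= e0 H]; exists e => // v vu; apply: H.
by rewrite -ball_normE /ball_/= distrC (le_lt_trans (mx_norm_le_enorm _)).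
Qed.

End VectorTheory.

Lemma dot_mulmx (m n : nat) (M : 'M[R]_(m, n)) (u : 'cV[R]_n) (v : 'cV[R]_m) :
  dot (M *m u) v = dot u (M^T *m v).
Proof.
transitivity (\sum_i \sum_j M i j * u j ord0 * v i ord0).
  by apply: eq_bigr => i _; rewrite mxE mulr_suml.
rewrite exchange_big; apply: eq_bigr => j _; rewrite mxE mulr_sumr.
by apply: eq_bigr => i _; rewrite mxE; rewrite -mulrA mulrCA mulrA.
Qed.

Lemma mulmx_bounded (m n : nat) (M : 'M[R]_(m, n)) :
  exists2 C : R, 0 <= C & forall v, enorm (M *m v) <= C * enorm v.
Proof.
exists (\sum_i enorm (row i M)^T); first by apply: sumr_ge0 => i _; exact: enorm_ge0.
move=> v; apply: le_trans (enorm_le_sum _) _; rewrite mulr_suml.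
apply: ler_sum => i _.
have -> : (M *m v) i ord0 = dot (row i M)^T v.
  by rewrite mxE; apply: eq_bigr => j _; rewrite !mxE.
by rewrite ler_norml dot_ge_enorm dot_le_enorm.
Qed.

End EuclideanTheory.

(** * Gradients, directional derivatives and first-order conditions *)

Section Calculus.
Context {R : realType} {n : nat}.
Implicit Types (u v x g : 'cV[R]_n) (D : set 'cV[R]_n) (f F : 'cV[R]_n -> R).

Lemma diff_dot f x v : 'd f x v = dot (grad f x) v.
Proof.
have {1}-> : v = \sum_i v i ord0 *: delta_mx i ord0.
  by rewrite {1}[v]matrix_sum_delta; apply: eq_bigr => i _; rewrite big_ord1.
rewrite linear_sum; apply: eq_bigr => i _.
by rewrite linearZ/= mxE mulrC.
Qed.

Lemma dir_quotient_cvg F x v : differentiable F x ->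
  (fun t : R => t^-1 * (F (x + t *: v) - F x)) @ 0^' --> dot (grad F x) v.
Proof.
move=> dF; rewrite -diff_dot -(deriveE (W := R^o)) //.
under eq_fun do rewrite (addrC x).
exact: (@diff_derivable _ _ R^o F x v dF).
Qed.

Lemma dnbhs0_small (P : set R) (d : R) : (\forall t \near 0^', P t) -> 0 < d ->
  exists t, [/\ 0 < t, t < d & P t].
Proof.
rewrite near_withinE => /nbhs_ballP[e /= e0 He] d0.
pose t := Num.min e d / 2.
have m0 : 0 < Num.min e d by rewrite lt_min e0.
have t0 : 0 < t by rewrite divr_gt0.
have tm : t < Num.min e d by rewrite ltr_pdivrMr// ltr_pMr// ltr1n.
have te : t < e by rewrite (lt_le_trans tm)// ge_min lexx.
exists t; split=> //; first by rewrite (lt_le_trans tm)// ge_min lexx orbT.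
by apply: He; rewrite ?(lt0r_neq0 t0)// /ball/= sub0r normrN gtr0_norm.
Qed.

Lemma le_grad_dot F x v (a d : R) : differentiable F x -> 0 < d ->
  (forall t : R, 0 < t -> t < d -> t * a <= F (x + t *: v) - F x) ->
  a <= dot (grad F x) v.
Proof.
move=> dF d0 H; rewrite leNgt; apply/negP => lta.
have /cvgr_lt/(_ _ lta) := dir_quotient_cvg dF (v := v).
move=> /dnbhs0_small/(_ d0)[t [t0 td]].
by rewrite ltNge ler_pdivlMl// H.
Qed.

Lemma grad_dot_le F x v (a d : R) : differentiable F x -> 0 < d ->
  (forall t : R, 0 < t -> t < d -> F (x + t *: v) - F x <= t * a) ->
  dot (grad F x) v <= a.
Proof.
move=> dF d0 H; rewrite leNgt; apply/negP => lta.
have /cvgr_gt/(_ _ lta) := dir_quotient_cvg dF (v := v).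
move=> /dnbhs0_small/(_ d0)[t [t0 td]].
by rewrite ltNge ler_pdivrMl// H.
Qed.

Let dot_linear g : linear (dot g : 'cV[R]_n -> R^o).
Proof. by move=> a u v; rewrite dotDr dotZr. Qed.

HB.instance Definition _ g :=
  GRing.isLinear.Build R 'cV[R]_n R^o *:%R (dot g) (dot_linear g).

Lemma enorm_le_mx_norm u : enorm u <= n%:R * `|u|.
Proof.
apply: le_trans (enorm_le_sum _) _.
rewrite mulr_natl -[X in _ *+ X](card_ord n) -sumr_const; apply: ler_sum => i _.
by rewrite /Num.norm/= mx_normrE; apply: (le_bigmax_cond _ (j := (i, ord0))).
Qed.

Lemma near_dot g (e : R) : 0 < e -> \forall v \near (0 : 'cV[R]_n), `|dot g v| <= e.
Proof.
move=> e0; set c := enorm g * n%:R.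
have c0 : 0 <= c by rewrite mulr_ge0 ?enorm_ge0.
apply/nbhs_ballP; exists (e / (c + 1)) => /=; first by rewrite divr_gt0// ltr_wpDl.
move=> v; rewrite -ball_normE /ball_/= sub0r normrN => /ltW vlt.
have : `|dot g v| <= c * `|v|.
  rewrite -mulrA (le_trans _ (ler_wpM2l (enorm_ge0 g) (enorm_le_mx_norm v)))//.
  by rewrite ler_norml dot_ge_enorm dot_le_enorm.
move/le_trans; apply; apply: le_trans (ler_wpM2l c0 vlt) _.
rewrite mulrA ler_pdivrMr ?ltr_wpDl//; nra.
Qed.

Lemma dot_continuous g : continuous (dot g : 'cV[R]_n -> R^o).
Proof.
apply: continuousfor0_continuous; rewrite /prop_for/continuous_at.
rewrite linear0; apply: (cvgr0Pnorm_le (FF := nbhs_filter (0 : 'cV[R]_n)) _).2.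
exact: near_dot.
Qed.

(** A quadratic remainder is negligible against [v], so uniqueness of the differential identifies
    the gradient. Quadratic functions can then be differentiated by expanding them. *)
Lemma diff_quadratic F x g (C : R) :
  (forall v, `|F (x + v) - F x - dot g v| <= C * enorm v ^+ 2) ->
  differentiable F x /\ grad F x = g.
Proof.
move=> H.
have E : F \o shift x = cst (F x) + (dot g : 'cV[R]_n -> R^o) +o_ (0 : 'cV[R]_n) id.
  apply/eqaddoP => _/posnumP[e].
  pose c := `|C| * n%:R ^+ 2.
  have c0 : 0 <= c by rewrite mulr_ge0// exprn_ge0.
  apply/nbhs_ballP; exists (e%:num / (c + 1)) => /=; first by rewrite divr_gt0// ltr_wpDl.
  move=> v; rewrite -ball_normE /ball_/= sub0r normrN => /ltW vlt.
  rewrite !fctE/= (addrC v) opprD addrA; apply: le_trans (H v) _.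
  apply: (@le_trans _ _ (c * `|v| ^+ 2)).
    rewrite -mulrA -exprMn (@le_trans _ _ (`|C| * enorm v ^+ 2))//.
      by rewrite ler_wpM2r ?sqr_ge0// ler_norm.
    by rewrite ler_wpM2l// lerXn2r ?nnegrE ?enorm_ge0 ?mulr_ge0// enorm_le_mx_norm.
  rewrite expr2 mulrA ler_wpM2r//.
  apply: le_trans (ler_wpM2l c0 vlt) _.
  have e0 : 0 < e%:num by [].
  rewrite mulrA ler_pdivrMr ?ltr_wpDl//; nra.
have := diff_unique (@dot_continuous g) E => dE.
split.
  by apply/diff_locallyP; rewrite dE; split => //; exact: dot_continuous.
apply/matrixP => i j; rewrite (ord1 j) mxE.
have := congr1 (@^~ (delta_mx i ord0)) dE => /= ->.
exact: etrans (dotC _ _) (dot_delta _ _).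
Qed.

Lemma argmin_is_argmin D F : D !=set0 -> compact D -> continuous F ->
  is_argmin D F (argmin D F).
Proof.
move=> D0 cD cF; apply: xgetPex.
have [u uD Hu] := compact_EVT_min D0 cD (continuous_subspaceT cF).
by exists u; split; [exact: set_mem|move=> v vD; apply: Hu; exact: mem_set].
Qed.

(** Convexity with a real parameter [t], which avoids the interval type in [convex_set]. *)
Definition segment_closed D :=
  forall u v (t : R), D u -> D v -> 0 <= t <= 1 -> D (u + t *: (v - u)).

Lemma convex_set_segment D : convex_set D -> segment_closed D.
Proof.
move=> cD u v t Du Dv /andP[t0 t1].
have := cD v u (Itv01 t0 t1) (mem_set Dv) (mem_set Du) => /set_mem.
rewrite -[X in D X]/(t *: v + (1 - t) *: u).
by rewrite scalerBl scale1r scalerBr addrCA.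
Qed.

Lemma argmin_first_order D F u : segment_closed D -> differentiable F u ->
  is_argmin D F u -> forall v, D v -> 0 <= dot (grad F u) (v - u).
Proof.
move=> cD dF [Du uF] v Dv; apply: (le_grad_dot (d := 1)) => // t t0 t1.
rewrite mulr0 subr_ge0; apply: uF.
by apply: cD; rewrite ?(ltW t0) ?(ltW t1).
Qed.

Lemma convex_gradient_ineq F u v : convex_function setT F -> differentiable F u ->
  dot (grad F u) (v - u) <= F v - F u.
Proof.
move=> cF dF; apply: (grad_dot_le (d := 1)) => // t t0 t1.
have := cF (Itv01 (ltW t0) (ltW t1)) v u (mem_set I) (mem_set I).
rewrite -[X in F X]/(t *: v + (1 - t) *: u) -[X in _ <= X]/(t * F v + (1 - t) * F u).
rewrite scalerBl scale1r addrCA -scalerBr; lra.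
Qed.

End Calculus.

(** * Farkas' lemma and Caratheodory reduction with sign-free and nonnegative coefficients *)

Section ConicCombinations.
Context {R : realType} {n : nat} {I : finType}.
Implicit Types (nn : pred I) (q : I -> 'cV[R]_n) (lam mu eta : I -> R).

(* Bartl's proof: if the constraint a is needed, there is a direction d0 that
   violates the conclusion but only the constraint a; projecting along d0 onto
   the orthogonal of q a removes this constraint. *)
Lemma farkas nn (s : seq I) q (g : 'cV[R]_n) : uniq s ->
  (forall d, (forall i, i \in s ->
      if nn i then dot (q i) d <= 0 else dot (q i) d == 0) -> dot g d <= 0) ->
  exists lam, [/\ forall i, i \notin s -> lam i = 0,
    forall i, nn i -> 0 <= lam i & g = \sum_i lam i *: q i].
Proof.
elim: s q g => [|a s IH] q g /=.
  move=> _ /(_ g) gg; exists (fun=> 0); split=> //.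
  have /eqP : dot g g = 0 by apply/eqP; rewrite eq_le gg ?dot_ge0.
  rewrite -enorm_sqr sqrf_eq0 enorm_eq0 => /eqP ->.
  by rewrite big1// => i _; rewrite scale0r.
move=> /andP[as_ us] H.
have [H0|] := pselect (forall d, (forall i, i \in s ->
      if nn i then dot (q i) d <= 0 else dot (q i) d == 0) -> dot g d <= 0).
  have [lam [l0 lnn lg]] := IH q g us H0.
  by exists lam; split=> // i; rewrite inE negb_or => /andP[_]; exact: l0.
move=> /existsNP[d0 /not_implyP[Hd0 /negP]]; rewrite -ltNge => gd0.
pose c := dot (q a) d0.
have caP : if nn a then 0 < c else c != 0.
  have Hc : ~ (if nn a then c <= 0 else c == 0).
    move=> Hc; move: gd0; rewrite ltNge => /negP; apply; apply: H => i.
    by rewrite inE => /orP[/eqP ->|/Hd0].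
  by case: (nn a) Hc => /negP//; rewrite -ltNge.
have c0 : c != 0 by case: (nn a) caP => // /lt0r_neq0.
pose q' i := q i - (dot (q i) d0 / c) *: q a.
have [|lam [l0 lnn lg]] := IH q' (g - (dot g d0 / c) *: q a) us.
  move=> d Hd; pose e := d - (dot (q a) d / c) *: d0.
  have E v : dot (v - (dot v d0 / c) *: q a) d = dot v e.
    rewrite /e dotBl dotBr dotZl dotZr; congr (_ - _).
    by rewrite mulrAC [RHS]mulrAC [dot (q a) d * _]mulrC.
  rewrite E; apply: H => i; rewrite inE => /orP[/eqP ->|/Hd]; last by rewrite E.
  have -> : dot (q a) e = 0 by rewrite /e dotBr dotZr -/c divfK// subrr.
  by rewrite lexx eqxx; case: ifP.
pose S := \sum_i lam i * dot (q i) d0.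
exists (fun i => if i == a then (dot g d0 - S) / c else lam i); split.
- by move=> i; rewrite inE negb_or => /andP[/negbTE -> /l0].
- move=> i nni; case: eqVneq => [ia|_]; last exact: lnn.
  move: caP; rewrite -ia nni => cgt0; rewrite divr_ge0 ?(ltW cgt0)// subr_ge0.
  rewrite (le_trans _ (ltW gd0))//; apply: sumr_le0 => j _.
  have [js|/l0 ->] := boolP (j \in s); last by rewrite mul0r.
  have := Hd0 j js; case: ifP => [nnj qj|_ /eqP ->]; last by rewrite mulr0.
  by rewrite mulr_ge0_le0 ?lnn.
rewrite (bigD1 a)//= eqxx.
rewrite (eq_bigr (fun i => lam i *: q i)); last by move=> i /negbTE ->.
have -> : \sum_(i | i != a) lam i *: q i = \sum_i lam i *: q i.
  by rewrite [RHS](bigD1 a)//= l0// scale0r add0r.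
have : g - (dot g d0 / c) *: q a = \sum_i lam i *: q i - (S / c) *: q a.
  rewrite lg /S mulr_suml scaler_suml -sumrB; apply: eq_bigr => i _.
  by rewrite scalerBr scalerA mulrA.
move/eqP; rewrite subr_eq => /eqP gE.
by rewrite [LHS]gE mulrBl scalerBl addrAC [RHS]addrC addrA.
Qed.

(** Caratheodory: while the vectors in the support are dependent, subtract a multiple of a
    dependency that makes one coefficient vanish and keeps the constrained signs. The support
    shrinks strictly, which gives the induction. *)
Lemma conic_reduction nn q lam : (forall i, nn i -> 0 <= lam i) ->
  exists mu, [/\ forall i, nn i -> 0 <= mu i,
    \sum_i mu i *: q i = \sum_i lam i *: q i,
    forall i, mu i != 0 -> lam i != 0 &
    forall eta, (forall i, mu i = 0 -> eta i = 0) ->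
      \sum_i eta i *: q i = 0 -> forall i, eta i = 0].
Proof.
have [k] := ubnP #|[pred i | lam i != 0]|.
elim: k => // k IH in lam *; rewrite ltnS => supp_k lam_ge0.
have [ind|] := pselect (forall eta, (forall i, lam i = 0 -> eta i = 0) ->
    \sum_i eta i *: q i = 0 -> forall i, eta i = 0); first by exists lam.
move=> /existsNP[eta /not_implyP[eta_supp /not_implyP[eta_sum /existsNP[i0 /eqP etai0]]]].
suff [eta' [t [j [eta'_supp eta'_sum etaj lamj ge0]]]] :
    exists eta' t j, [/\ forall i, lam i = 0 -> eta' i = 0,
      \sum_i eta' i *: q i = 0, eta' j != 0, lam j = t * eta' j &
      forall i, nn i -> 0 <= lam i - t * eta' i].
  have [] := IH (fun i => lam i - t * eta' i) _ ge0.
    apply: leq_trans supp_k; apply: proper_card; apply/properP; split.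
      apply/fintype.subsetP => i; rewrite !inE; apply: contra => /eqP li.
      by rewrite li eta'_supp// mulr0 subrr.
    exists j; rewrite !inE; last by rewrite lamj subrr eqxx.
    by apply: contra etaj => /eqP /eta'_supp ->.
  move=> mu [mu0 mus musupp muind]; exists mu; split=> //.
    rewrite mus; under eq_bigr do rewrite scalerBl -scalerA.
    by rewrite sumrB -scaler_sumr eta'_sum scaler0 subr0.
  move=> i /musupp; apply: contra => /eqP li.
  by rewrite li eta'_supp// mulr0 subrr.
(* If the dependency avoids all sign-constrained indices, any nonzero entry of it can be eliminated
   at once. *)
have [/existsP[i1 /andP[nni1 etai1]]|] := boolP [exists i, nn i && (eta i != 0)]; last first.
  rewrite negb_exists => /forallP H; exists eta, (lam i0 / eta i0), i0; split=> //.
    by rewrite divfK.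
  move=> i nni; have := H i; rewrite nni/= negbK => /eqP ->.
  by rewrite mulr0 subr0 lam_ge0.
(* A dependency may be negated. Once it has a positive constrained entry, the smallest ratio
   [lam i / eta i] tells which constrained coefficient reaches zero first. *)
wlog etai1_gt0 : eta eta_supp eta_sum etai0 etai1 / 0 < eta i1.
  move=> H; move: (etai1); rewrite neq_lt => /orP[ei|]; last exact: (H eta).
  apply: (H (fun i => - eta i)); rewrite ?oppr_eq0 ?oppr_gt0 ?etai0 ?etai1//.
  - by move=> i /eta_supp ->; rewrite oppr0.
  - by under eq_bigr do rewrite scaleNr; rewrite sumrN eta_sum oppr0.
pose P i := nn i && (0 < eta i).
have Pi1 : P i1 by rewrite /P nni1.
case: (arg_minP (fun i => lam i / eta i) Pi1) => j /andP[nnj etaj] jmin.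
exists eta, (lam j / eta j), j; split=> //.
- by rewrite lt0r_neq0.
- by rewrite divfK// lt0r_neq0.
move=> i nni; rewrite subr_ge0; case: (leP (eta i) 0) => ei.
  by rewrite (le_trans _ (lam_ge0 i nni))// mulr_ge0_le0// divr_ge0 ?lam_ge0// ltW.
by rewrite -ler_pdivlMr//; apply: jmin; rewrite /P nni.
Qed.

End ConicCombinations.

(** * Karush-Kuhn-Tucker conditions under Slater's condition *)

Section OptimalityConditions.
Context {R : realType} {n m l : nat}.
Variables (A : 'M[R]_(m, n)) (h : 'I_l -> 'cV[R]_n -> R).
Implicit Types (x d G : 'cV[R]_n) (S : {set 'I_(m + l)}).

Definition Qrow x (i : 'I_(m + l)) : 'cV[R]_n := (row i (Qmx A h x))^T.

Lemma Qrow_lshift x i : Qrow x (lshift l i) = (row i A)^T.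
Proof. by rewrite /Qrow /Qmx rowKu. Qed.

Lemma Qrow_rshift x j : Qrow x (rshift m j) = grad (h j) x.
Proof. by rewrite /Qrow /Qmx rowKd rowK trmxK. Qed.

Lemma dot_row (k : nat) (M : 'M[R]_(k, n)) i d : dot (row i M)^T d = (M *m d) i ord0.
Proof. by rewrite mxE; apply: eq_bigr => j _; rewrite !mxE. Qed.

Lemma trQmx_mul x (lam : 'cV[R]_(m + l)) :
  (Qmx A h x)^T *m lam = \sum_i lam i ord0 *: Qrow x i.
Proof.
apply/matrixP => i j; rewrite (ord1 j) mxE summxE; apply: eq_bigr => k _.
by rewrite !mxE mulrC.
Qed.

Lemma active_lshift x (i : 'I_m) : lshift l i \in active h x.
Proof. by rewrite inE (unsplitK (inl i : 'I_m + 'I_l)). Qed.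

Lemma active_rshift x (j : 'I_l) : (rshift m j \in active (m := m) h x) = (h j x == 0).
Proof. by rewrite inE (unsplitK (inr j : 'I_m + 'I_l)). Qed.

Definition csupp (lam : 'cV[R]_(m + l)) : {set 'I_(m + l)} :=
  [set i | lam i ord0 != 0]%SET.

Lemma Qsub_row_free S x :
  (forall eta : 'I_(m + l) -> R, (forall i, i \notin S -> eta i = 0) ->
     \sum_i eta i *: Qrow x i = 0 -> forall i, eta i = 0) ->
  row_free (Qsub A h S x).
Proof.
move=> ind; rewrite -kermx_eq0; apply/rowV0P => v /sub_kermxP vQ.
(* The row vector [v], indexed by positions in [S], is extended by zero to all constraint indices;
   each sum has at most one term. *)
pose eta i := \sum_(k < #|S| | enum_val k == i) v ord0 k.
have eta0 i : eta i = 0.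
  apply: ind => {i} [i iS|].
    rewrite /eta big1// => k /eqP ki; move: iS; rewrite -ki => /negP[].
    exact: enum_valP.
  transitivity ((v *m Qsub A h S x)^T); last by rewrite vQ trmx0.
  transitivity (\sum_(k < #|S|) v ord0 k *: Qrow x (enum_val k)).
    under eq_bigr do rewrite scaler_suml.
    rewrite (exchange_big_dep predT)//=; apply: eq_bigr => k _.
    by rewrite (big_pred1 (enum_val k))// => i; rewrite eq_sym.
  apply/matrixP => i j; rewrite (ord1 j) summxE !mxE; apply: eq_bigr => k _.
  by rewrite !mxE.
apply/matrixP => i k; rewrite (ord1 i) [RHS]mxE -(eta0 (enum_val k)) /eta.
by rewrite (big_pred1 k)// => k'; rewrite (inj_eq enum_val_inj).
Qed.

Hypothesis h_diff : forall j x, differentiable (h j) x.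
Hypothesis h_convex : forall j, convex_function setT (h j).

Lemma feasible_direction x d : constr_set h x ->
  (forall j, h j x = 0 -> dot (grad (h j) x) d < 0) ->
  exists2 t : R, 0 < t & constr_set h (x + t *: d).
Proof.
move=> xX Hd.
have : \forall t \near (0 : R)^', forall j, 0 < t -> h j (x + t *: d) <= 0.
  apply: filter_forall => j; have [hx0|hx0] := eqVneq (h j x) 0.
    have /cvgr_lt/(_ _ (Hd j hx0)) := dir_quotient_cvg (h_diff j x) (v := d).
    apply: filterS => t; rewrite hx0 subr0 => + t0.
    by rewrite pmulr_rlt0 ?invr_gt0// => /ltW.
  have hlt : h j x < 0 by rewrite lt_neqAle hx0; exact: xX.
  (* An inactive constraint grows at a rate below [a] for small [t], so it stays negative while
     [t < - h j x / a]. *)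
  pose a := `|dot (grad (h j) x) d| + 1.
  have a0 : 0 < a by rewrite ltr_wpDl.
  have /cvgr_lt/(_ a) := dir_quotient_cvg (h_diff j x) (v := d).
  rewrite (le_lt_trans (ler_norm _)) ?ltrDl// => /(_ isT) Ha.
  have Hs : \forall t \near (0 : R)^', `|t| < - h j x / a.
    by apply: dnbhs0_lt; rewrite divr_gt0// oppr_gt0.
  near=> t => t0.
  have : t^-1 * (h j (x + t *: d) - h j x) < a by near: t.
  have : `|t| < - h j x / a by near: t.
  rewrite gtr0_norm// ltr_pdivlMr// ltr_pdivrMl//; lra.
move=> /dnbhs0_small/(_ ltr01)[t [t0 _ Ht]].
by exists t => // j; exact: Ht.
Unshelve. all: by end_near. Qed.

(** Farkas' lemma applies to [- G]: a direction [d] of the linearized cone with [dot G d < 0] could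
    be tilted towards the Slater point, which makes it strictly decreasing for the active
    constraints, hence feasible, and contradicts the variational inequality. [conic_reduction] then
    makes the active gradients in the support independent. *)
Lemma kkt x G : constr_set h x ->
  (exists x1, A *m x1 = A *m x /\ forall j, h j x1 < 0) ->
  (forall v, constr_set h v -> A *m v = A *m x -> 0 <= dot G (v - x)) ->
  exists lam : 'cV[R]_(m + l),
    [/\ G + (Qmx A h x)^T *m lam = 0,
        forall j, 0 <= lam (rshift m j) ord0,
        csupp lam \subset active h x &
        row_free (Qsub A h (csupp lam) x)].
Proof.
move=> xX [x1 [Ax1 hx1]] HG.
(* Only the multipliers of inequality constraints have a prescribed sign. *)
pose nn (i : 'I_(m + l)) := if fintype.split i is inr _ then true else false.
have nnl i : nn (lshift l i) = false by rewrite /nn (unsplitK (inl i : 'I_m + 'I_l)).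
have nnr j : nn (rshift m j) by rewrite /nn (unsplitK (inr j : 'I_m + 'I_l)).
have [|lam [lam0 lam_ge0 lamG]] := farkas (nn := nn) (q := Qrow x) (g := - G)
    (enum_uniq (mem (active h x))).
  move=> d Hd; rewrite dotNl oppr_le0 leNgt; apply/negP => Gd.
  pose e := x1 - x.
  have Ae : A *m e = 0 by rewrite mulmxBr Ax1 subrr.
  have Ad : A *m d = 0.
    apply/matrixP => i j; rewrite (ord1 j) [RHS]mxE -dot_row -(Qrow_lshift x).
    have := Hd (lshift l i); rewrite nnl mem_enum => /(_ (active_lshift x i)).
    by move/eqP.
  (* The tilt changes [dot G d] by less than half its size; the [+ 1] keeps the denominator
     positive. *)
  pose tau := - dot G d / (2 * (`|dot G e| + 1)).
  have den0 : 0 < 2 * (`|dot G e| + 1) by rewrite mulr_gt0// ltr_wpDl.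
  have tau0 : 0 < tau by rewrite divr_gt0// oppr_gt0.
  have Gde : dot G (d + tau *: e) < 0.
    rewrite dotDr dotZr.
    have : tau * dot G e <= tau * `|dot G e| by rewrite ler_wpM2l ?ler_norm ?(ltW tau0).
    have : tau * (2 * (`|dot G e| + 1)) = - dot G d by rewrite divfK// lt0r_neq0.
    lra.
  have [j hj0|t t0 tX] := feasible_direction (d := d + tau *: e) xX.
    rewrite dotDr dotZr.
    have := Hd (rshift m j); rewrite nnr mem_enum active_rshift hj0 Qrow_rshift.
    move=> /(_ (eqxx _)) Hdj.
    have : dot (grad (h j) x) e < 0.
      by rewrite (le_lt_trans (convex_gradient_ineq _ (h_convex j) (h_diff j x)))// hj0 subr0.
    nra.
  have := HG _ tX; rewrite mulmxDr -scalemxAr mulmxDr -scalemxAr Ad Ae.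
  rewrite scaler0 addr0 scaler0 addr0 => /(_ erefl).
  by rewrite addrAC subrr add0r dotZr pmulr_rge0// leNgt Gde.
have [mu [mu_ge0 mu_sum mu_supp mu_ind]] := conic_reduction (Qrow x) lam_ge0.
pose M : 'cV[R]_(m + l) := \col_i mu i.
have suppE i : (i \in csupp M) = (mu i != 0) by rewrite !inE mxE.
exists M; split.
- rewrite trQmx_mul; under eq_bigr do rewrite mxE.
  by rewrite mu_sum -lamG subrr.
- by move=> j; rewrite mxE mu_ge0.
- apply/fintype.subsetP => i; rewrite suppE => /mu_supp; apply: contraNT => iS.
  by rewrite lam0// mem_enum.
apply: Qsub_row_free => eta eta0; apply: mu_ind => i mui; apply: eta0.
by rewrite suppE mui eqxx.
Qed.

End OptimalityConditions.

(** * Finite chains of points with finitely many labels *)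

Lemma labelled_chain (R : realType) (n : nat) (T : finType) (x : nat -> 'cV[R]_n)
    (s : nat -> T) (C e : R) (N : nat) : 0 <= C -> 0 <= e ->
  (forall i j, (i <= j <= N)%N -> s i = s j ->
     enorm (x i - x j) <= C * (j - i)%:R) ->
  (forall i, (i < N)%N -> enorm (x i - x i.+1) <= e) ->
  enorm (x 0%N - x N) <= C * N%:R + #|T|%:R * e.
Proof.
move=> C0 e0 Hs He.
suff H : forall k (F : {set T}) i, (#|F| <= k)%N -> (i <= N)%N ->
    (forall j, (i <= j <= N)%N -> s j \in F) ->
    enorm (x i - x N) <= C * (N - i)%:R + k%:R * e.
  have := H #|T| [set: T]%SET 0%N; rewrite cardsT subn0; exact.
(* From i, jump to the last index with the same label, then make one step:
   the label of i never occurs again. *)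
elim=> [|k IH] F i Fk iN HF.
  move: Fk; rewrite leqn0 => /eqP/cards0_eq F0.
  by have := HF i; rewrite leqnn iN F0 inE => /(_ isT).
pose P j := (i <= j <= N)%N && (s j == s i).
have [j /andP[/andP[ij jN] /eqP sji] jmax] : exists2 j, P j & forall j', P j' -> (j' <= j)%N.
  have exP : exists j, P j by exists i; rewrite /P leqnn iN eqxx.
  have Pub j : P j -> (j <= N)%N by move=> /andP[/andP[]].
  by case: (ex_maxnP exP Pub) => j Pj jm; exists j.
have xij : enorm (x i - x j) <= C * (j - i)%:R by apply: Hs; rewrite ?ij ?jN.
have [jN'|Nj] := ltnP j N; last first.
  have -> : N = j by apply/eqP; rewrite eqn_leq Nj jN.
  by rewrite (le_trans xij)// lerDl mulr_ge0.
have := IH (F :\ s i)%SET j.+1 _ jN' _.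
have sF : s i \in F by apply: HF; rewrite leqnn iN.
move: Fk; rewrite (cardsD1 (s i)) sF add1n ltnS => Fk /(_ Fk) xjN.
have {}xjN : enorm (x j.+1 - x N) <= C * (N - j.+1)%:R + k%:R * e.
  apply: xjN => j' /andP[jj' j'N]; rewrite in_setD1 HF; last first.
    by rewrite j'N andbT (leq_trans ij (ltnW jj')).
  rewrite andbT; apply/eqP => sj'; have := jj'; rewrite ltnNge => /negP; apply.
  apply: jmax; rewrite /P sj' eqxx andbT j'N andbT.
  exact: leq_trans ij (ltnW jj').
have xjj := He j jN'.
have := enorm_tri (x i) (x j) (x N); have := enorm_tri (x j) (x j.+1) (x N).
have -> : (N - i)%:R = (j - i)%:R + 1 + (N - j.+1)%:R :> R.
  rewrite -[1]/(1%:R) -!natrD; congr (_%:R).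
  by lia.
rewrite -natr1; lra.
Qed.

(** * Uniform multiplier bounds from the constant rank condition *)

Section ConstantRank.
Context {R : realType} {n m l : nat}.
Variables (A : 'M[R]_(m, n)) (h : 'I_l -> 'cV[R]_n -> R).
Implicit Types (x : 'cV[R]_n) (S : {set 'I_(m + l)}) (lam : 'cV[R]_(m + l)).

Lemma trQmx_supported S lam x : csupp lam \subset S ->
  (Qmx A h x)^T *m lam = (Qsub A h S x)^T *m \col_k lam (enum_val k) ord0.
Proof.
move=> lamS; rewrite trQmx_mul (bigID (mem S))/= [X in _ + X]big1 ?addr0.
  rewrite big_enum_val; apply/matrixP => i j; rewrite (ord1 j) summxE !mxE.
  by apply: eq_bigr => k _; rewrite !mxE mulrC.
move=> i iS; have := contraNN (fintype.subsetP lamS i) iS.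
by rewrite !inE negbK => /eqP ->; rewrite scale0r.
Qed.

(** The transpose of a right inverse of [Qsub A h S x] recovers the entries on [S]; a 0/1 matrix
    puts them back at their indices and pads with zeros. *)
Lemma row_free_Qsub_left_inverse S x : row_free (Qsub A h S x) ->
  exists M : 'M[R]_(m + l, n), forall lam, csupp lam \subset S ->
    M *m ((Qmx A h x)^T *m lam) = lam.
Proof.
move=> /row_freeP[B QB]; exists ((\matrix_(i, k) (enum_val k == i)%:R) *m B^T).
move=> lam lamS; rewrite (trQmx_supported x lamS) -mulmxA (mulmxA B^T) -trmx_mul QB.
rewrite trmx1 mul1mx; apply/matrixP => i j; rewrite (ord1 j) mxE.
have [iS|iS] := boolP (i \in S).
  rewrite (bigD1 (enum_rank_in iS i))//= !mxE enum_rankK_in// eqxx mul1r.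
  rewrite big1 ?addr0// => k ki; rewrite mxE; case: eqP => [ei|]; last by rewrite mul0r.
  by case/eqP: ki; apply: enum_val_inj; rewrite enum_rankK_in.
have := contraNN (fintype.subsetP lamS i) iS; rewrite !inE negbK => /eqP ->.
rewrite big1// => k _; rewrite mxE; case: eqP => [ei|]; last by rewrite mul0r.
by case/negP: iS; rewrite -ei enum_valP.
Qed.

(** The rows of [A] cancel in the difference; each of the [l] gradient rows contributes one
    Lipschitz term. *)
Lemma trQmx_lipschitz Lh : (forall j, grad_lipschitz_on setT Lh (h j)) ->
  forall x x' lam, enorm ((Qmx A h x)^T *m lam - (Qmx A h x')^T *m lam) <=
    l%:R * `|Lh| * enorm (x - x') * enorm lam.
Proof.
move=> hL x x' lam; rewrite [X in enorm (X - _)]trQmx_mul [X in enorm (_ - X)]trQmx_mul.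
rewrite -sumrB big_split_ord/= big1 ?add0r; last first.
  by move=> i _; rewrite !Qrow_lshift subrr.
apply: le_trans (enorm_sum _ _) _.
rewrite -!mulrA mulr_natl -[X in _ *+ X](card_ord l) -sumr_const; apply: ler_sum => j _.
rewrite -scalerBr enormZ !Qrow_rshift [leRHS]mulrA mulrC.
apply: ler_pM; rewrite ?enorm_ge0 ?coord_le_enorm//.
apply: le_trans (hL j x x' I I) _.
by rewrite ler_wpM2r ?enorm_ge0// ler_norm.
Qed.

(** The smallness of [e] gives [K * L * e <= 1/2], so the term in [a] on the right is absorbed on
    the left. *)
Let perturbed_bound (K L e a b c : R) : 0 <= K -> 0 <= L -> 0 <= e -> 0 <= a ->
  e * (2 * (K * L + 1)) < 1 -> a <= K * b -> b <= c + L * e * a -> a <= 2 * K * c.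
Proof.
move=> K0 L0 e0 a0 eKL aKb bc.
have KLe : K * L * e <= 2^-1 by lra.
have := ler_wpM2r a0 KLe; have := ler_wpM2l K0 bc; lra.
Qed.

(** Constraints active near [xb] are active at [xb], so constant rank carries the independence of
    [S] from [x] back to [xb]. There a left inverse bounds the multiplier, with one constant for the
    finitely many [S], and Lipschitz continuity of the gradients transports the bound to [x]. *)
Lemma crcq_multiplier_bound Lh xb :
  (forall j, continuous (h j)) ->
  (forall j, grad_lipschitz_on setT Lh (h j)) ->
  (forall S, S != finset.set0 -> S \subset active h xb ->
     exists r : nat, \forall x \near xb, \rank (Qsub A h S x) = r) ->
  exists rho kappa : R, [/\ 0 < rho, 0 <= kappa &
    forall x S lam, enorm (x - xb) < rho -> S \subset active h x ->
      row_free (Qsub A h S x) -> csupp lam \subset S ->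
      enorm lam <= kappa * enorm ((Qmx A h x)^T *m lam)].
Proof.
move=> h_cont h_lip cr.
have rank_near : \forall x \near xb, forall S, S \subset active h xb ->
    \rank (Qsub A h S x) = \rank (Qsub A h S xb).
  (* The rank hypothesis only speaks of nonempty [S]; the empty set has rank 0 everywhere. *)
  apply: (@filter_forall _ _ _ _ (nbhs_filter xb)) => S; have [->|S0] := eqVneq S finset.set0.
    have r0 x : \rank (Qsub A h finset.set0 x) = 0%N.
      by apply/eqP; rewrite -leqn0 (leq_trans (rank_leq_row _))// cards0.
    by apply: filterE => x _; exact: etrans (r0 x) (esym (r0 xb)).
  have [SA|SA] := boolP (S \subset active h xb); last by apply: filterE => x SA'; case/negP: SA.
  have [r Hr] := cr S S0 SA.
  by apply: filterS (Hr) => x Hx _; exact: etrans Hx (esym (nbhs_singleton Hr)).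
have active_near : \forall x \near xb, forall j, h j xb != 0 -> h j x != 0.
  apply: (@filter_forall _ _ _ _ (nbhs_filter xb)) => j.
  have [_|hj0] := eqVneq (h j xb) 0; first exact: filterE.
  have := h_cont j xb; rewrite /continuous_at => /cvgr_neq0/(_ hj0).
  exact: filterS.
have [rho0 rho0_gt0 Hrho0] := near_enorm (filterI rank_near active_near).
have HC S : exists C : R, 0 <= C /\ (row_free (Qsub A h S xb) ->
    forall lam, csupp lam \subset S -> enorm lam <= C * enorm ((Qmx A h xb)^T *m lam)).
  have [/row_free_Qsub_left_inverse[M HM]|nf] := boolP (row_free (Qsub A h S xb)).
    have [C C0 HC] := mulmx_bounded M; exists C; split=> // _ lam lamS.
    by rewrite -{1}(HM lam lamS) HC.
  by exists 0.
have [C HC'] := choice HC; pose K := \sum_S C S.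
have K0 : 0 <= K by apply: sumr_ge0 => S _; exact: (HC' S).1.
have CK S : C S <= K.
  by rewrite /K (bigD1 S)//= lerDl; apply: sumr_ge0 => S' _; exact: (HC' S').1.
pose L := l%:R * `|Lh|; have L0 : 0 <= L by rewrite mulr_ge0.
have KL0 : 0 < 2 * (K * L + 1) by rewrite mulr_gt0// ltr_wpDl ?mulr_ge0.
exists (Num.min rho0 (2 * (K * L + 1))^-1), (2 * K); split.
- by rewrite lt_min rho0_gt0 invr_gt0.
- by rewrite mulr_ge0.
move=> x S lam; rewrite lt_min => /andP[/Hrho0[Hrank Hact] xKL] SA Sfree lamS.
have SAb : S \subset active h xb.
  apply: (fintype.subset_trans SA); apply/fintype.subsetP => i; rewrite !inE.
  by case: fintype.split => // j; apply: contraTT; exact: Hact.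
have Sfreeb : row_free (Qsub A h S xb) by rewrite /row_free -[X in X == _](Hrank S SAb).
have H1 := (HC' S).2 Sfreeb lam lamS.
have {H1} H1 : enorm lam <= K * enorm ((Qmx A h xb)^T *m lam).
  by rewrite (le_trans H1)// ler_wpM2r ?enorm_ge0.
have H2 := trQmx_lipschitz h_lip xb x lam.
have H3 : enorm ((Qmx A h xb)^T *m lam) <=
    enorm ((Qmx A h x)^T *m lam) + L * enorm (x - xb) * enorm lam.
  rewrite (enormBC x) (le_trans _ (lerD (lexx _) H2))//.
  by rewrite addrC -{1}(subrK ((Qmx A h x)^T *m lam) ((Qmx A h xb)^T *m lam)) enormD.
have {}xKL : enorm (x - xb) * (2 * (K * L + 1)) < 1.
  by rewrite -ltr_pdivlMr// div1r.
exact: perturbed_bound K0 L0 (enorm_ge0 _) (enorm_ge0 _) xKL H1 H3.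
Qed.

End ConstantRank.

(* Pitfall: comparing norms of expressions at two distinct points makes lra
   and unification diverge, so norms and inner products are generalized to
   real variables first. *)
Ltac gen_norms := repeat match goal with
  | |- context [@enorm ?R ?n ?v] => generalize (@enorm R n v)
  | |- context [@dot ?R ?n ?u ?v] => generalize (@dot R n u v)
  end; repeat match goal with H : is_true _ |- _ => clear H | H : _ = _ |- _ => clear H end;
  intros.

(** * The strongly convex program with a perturbed right-hand side: monotonicity, feasibility and
    Hoelder stability *)

Section PerturbedProgram.
Context {R : realType} {n m l : nat}.
Variables (A : 'M[R]_(m, n)) (b : 'cV[R]_m).
Variables (f : 'cV[R]_n -> R) (h : 'I_l -> 'cV[R]_n -> R) (Lf Lh p : R).
Implicit Types (x u v w z : 'cV[R]_n).

Let X := constr_set h.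

Hypothesis f_smooth : smooth f.
Hypothesis X_compact : compact X.
Hypothesis X_convex : segment_closed X.
Hypothesis f_grad_lipschitz : grad_lipschitz_on X Lf f.
Hypothesis h_smooth : forall j, smooth (h j).
Hypothesis h_convex : forall j, convex_function setT (h j).
Hypothesis slater_cond : slater A b h.

Definition pgrad z x : 'cV[R]_n := grad f x + p *: (x - z).

(* The first-order condition for x to minimize f + p/2 |. - z|^2 over the
   points of X with the same image under A as x. Both x(y, z) and x(z) satisfy
   it, whatever y and gamma: the dual variable only selects the image A x. *)
Definition vi_sol z x : Prop :=
  X x /\ forall v, X v -> A *m v = A *m x -> 0 <= dot (pgrad z x) (v - x).

Lemma pgradB z x x' :
  pgrad z x - pgrad z x' = grad f x - grad f x' + p *: (x - x').
Proof.
rewrite /pgrad opprD addrACA -scalerBr.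
by rewrite (_ : x - z - (x' - z) = x - x') // opprB addrA subrK.
Qed.

Lemma pgrad_strongly_monotone z x x' : X x -> X x' ->
  (p - Lf) * enorm (x - x') ^+ 2 <= dot (pgrad z x - pgrad z x') (x - x').
Proof.
move=> xX x'X; rewrite pgradB dotDl dotZl -[X in p * X]enorm_sqr.
have H1 := dot_ge_enorm (grad f x - grad f x') (x - x').
have H2 := ler_wpM2r (enorm_ge0 (x - x')) (f_grad_lipschitz xX x'X).
move: H1 H2; gen_norms; lra.
Qed.

Lemma pgrad_lipschitz z x x' : X x -> X x' ->
  enorm (pgrad z x - pgrad z x') <= (`|Lf| + `|p|) * enorm (x - x').
Proof.
move=> xX x'X; rewrite pgradB; apply: le_trans (enormD _ _) _; rewrite enormZ mulrDl lerD2r.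
apply: le_trans (f_grad_lipschitz xX x'X) _.
by rewrite ler_wpM2r ?enorm_ge0 ?ler_norm.
Qed.

Lemma constr_set_bounded : exists2 D : R, 0 < D & forall x, X x -> enorm x <= D.
Proof.
have [M [_ HM]] := compact_bounded X_compact.
exists (n%:R * (`|M| + 1) + 1); first by rewrite ltr_wpDl// mulr_ge0// addr_ge0.
move=> x xX; apply: le_trans (enorm_le_mx_norm x) _.
apply: (@le_trans _ _ (n%:R * (`|M| + 1))); last by rewrite lerDl.
rewrite ler_wpM2l//; apply: HM => //.
by rewrite (le_lt_trans (ler_norm M))// ltrDl.
Qed.

Lemma pgrad_bounded : exists2 M : R, 0 <= M &
  forall z x, X z -> X x -> enorm (pgrad z x) <= M.
Proof.
have [D D0 HD] := constr_set_bounded.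
have [x0 [_ hx0]] := slater_cond.
have x0X : X x0 by move=> j; exact: ltW.
pose M : R := enorm (grad f x0) + (`|Lf| * (D + D) + `|p| * (D + D)).
exists M.
  by rewrite !addr_ge0 ?enorm_ge0// mulr_ge0// addr_ge0// ltW.
have BD x x' : X x -> X x' -> enorm (x - x') <= D + D.
  by move=> xX x'X; rewrite (le_trans (enormD _ _))// enormN lerD// HD.
move=> z x zX xX; apply: le_trans (enormD _ _) _.
have H1 : enorm (p *: (x - z)) <= `|p| * (D + D).
  by rewrite enormZ ler_wpM2l// BD.
have H2 : enorm (grad f x) <= enorm (grad f x0) + enorm (grad f x - grad f x0).
  rewrite -[X in enorm X <= _](subrKC (grad f x0) (grad f x)); exact: enormD.
have H3 := f_grad_lipschitz xX x0X.
have H4 : Lf * enorm (x - x0) <= `|Lf| * (D + D).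
  apply: (@le_trans _ _ (`|Lf| * enorm (x - x0))).
    by rewrite ler_wpM2r ?enorm_ge0 ?ler_norm.
  by rewrite ler_wpM2l// BD.
move: H1 H2 H3 H4; rewrite /M; gen_norms; lra.
Qed.

Lemma slater_ball : exists x0, exists2 e : R, 0 < e &
  A *m x0 = b /\ forall v, enorm (v - x0) < e -> forall j, h j v < 0.
Proof.
have [x0 [Ax0 hx0]] := slater_cond; exists x0.
have : \forall v \near x0, forall j, h j v < 0.
  apply: (@filter_forall _ _ _ _ (nbhs_filter x0)) => j.
  have := differentiable_continuous ((h_smooth j).1 x0).
  by move=> /cvgr_lt/(_ _ (hx0 j)).
by move=> /near_enorm[e e0 He]; exists e.
Qed.

(** [P] comes from a pseudo-inverse: it is a bounded linear right inverse of [A] on the range of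
    [A], which need not be everything. *)
Lemma mulmx_section : exists P : 'M[R]_(n, m), exists2 C : R, 0 < C &
  (forall e : 'cV[R]_n, A *m (P *m (A *m e)) = A *m e) /\
  (forall w : 'cV[R]_m, enorm (P *m w) <= C * enorm w).
Proof.
pose P := (pinvmx A^T)^T; have [C C0 HC] := mulmx_bounded P.
exists P, (C + 1); first by rewrite ltr_wpDl.
split=> [e|w]; last by rewrite (le_trans (HC w))// ler_wpM2r ?enorm_ge0// lerDl.
apply: trmx_inj; rewrite !trmx_mul trmxK mulmxKpV// mulmx_sub//.
Qed.

(** The Slater point is corrected by a displacement small enough to stay in its ball. This supplies
    the Slater hypothesis of [kkt] for right-hand sides near [b]. *)
Lemma strictly_feasible_lift : exists2 rho : R, 0 < rho &
  forall x, enorm (A *m x - b) <= rho ->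
  exists x1, A *m x1 = A *m x /\ forall j, h j x1 < 0.
Proof.
have [x0 [e e0 [Ax0 He]]] := slater_ball.
have [P [C C0 [AP PC]]] := mulmx_section.
exists (e / (2 * C)); first by rewrite divr_gt0// mulr_gt0.
move=> x xb; exists (x0 + P *m (A *m (x - x0))); split.
  by rewrite mulmxDr AP -mulmxDr addrC subrK.
apply: He; rewrite [X in enorm X]addrAC subrr add0r.
apply: le_lt_trans (PC _) _; rewrite mulmxBr Ax0.
move: xb; rewrite ler_pdivlMr ?mulr_gt0//; move: (enorm _) => r; nra.
Qed.

Lemma feasible_lift : exists C rho : R, [/\ 0 <= C, 0 < rho &
  forall v v', X v -> enorm (A *m v - b) <= rho -> enorm (A *m v' - b) <= rho ->
  exists w, [/\ X w, A *m w = A *m v' &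
    enorm (w - v) <= C * enorm (A *m v' - A *m v)]].
Proof.
(* v is moved a fraction theta of the way to x0 + d, where d stays in the
   Slater ball around x0 and is chosen to give the prescribed image. *)
have [x0 [e e0 [Ax0 He]]] := slater_ball.
have [P [C C0 [AP PC]]] := mulmx_section.
have [D D0 HD] := constr_set_bounded.
have x0X : X x0.
  by move=> j; apply/ltW/He; rewrite subrr enorm0.
pose rho := e / (4 * C).
have rho0 : 0 < rho by rewrite divr_gt0// mulr_gt0.
have rhoE : rho * (4 * C) = e by rewrite divfK// lt0r_neq0// mulr_gt0.
exists (2 * C / e * (D + D + e)), rho; split=> //.
  by rewrite mulr_ge0// ?divr_ge0// ?addr_ge0// ?mulr_ge0// ltW.
move=> v v' vX vb v'b.
have [s0|s0] := eqVneq (A *m v' - A *m v) 0.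
  exists v; split=> //; first by move/eqP: s0; rewrite subr_eq0 => /eqP.
  by rewrite subrr enorm0 s0 enorm0 mulr0.
set s := A *m v' - A *m v in s0 *.
have s_gt0 : 0 < enorm s by rewrite lt_neqAle enorm_ge0 eq_sym enorm_eq0 s0.
have s_le : enorm s <= 2 * rho.
  rewrite /s (_ : A *m v' - A *m v = (A *m v' - b) - (A *m v - b)); last first.
    by rewrite opprB addrA subrK.
  by rewrite (le_trans (enormD _ _))// enormN mulr2n mulrDl mul1r lerD.
(* With this choice [C * theta^-1 * enorm s] is [e / 2], while [C * rho] is [e / 4]; hence [d] stays
   in the Slater ball, and [enorm s <= 2 * rho] gives [theta <= 1]. *)
pose theta := 2 * C / e * enorm s.
have theta0 : 0 < theta by rewrite mulr_gt0// divr_gt0// mulr_gt0.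
have thetaE : theta * e = 2 * C * enorm s by rewrite /theta mulrAC divfK// lt0r_neq0.
have theta1 : theta <= 1 by nra.
pose d := P *m (A *m (theta^-1 *: (v' - v) + (v - x0))).
have Ad : A *m d = theta^-1 *: s + (A *m v - b).
  by rewrite /d AP mulmxDr -scalemxAr !mulmxBr Ax0.
have d_lt : enorm d < e.
  rewrite /d; apply: le_lt_trans (PC _) _; rewrite -AP -/d Ad.
  apply: le_lt_trans (ler_wpM2l (ltW C0) (enormD _ _)) _.
  rewrite enormZ gtr0_norm ?invr_gt0//.
  have : theta^-1 * enorm s * (2 * C) = e.
    by rewrite -mulrA (mulrC (enorm s)) -thetaE mulKf// lt0r_neq0.
  move: vb; move: (enorm (_ - b)) (theta^-1 * _) => r q; nra.
have x0dX : X (x0 + d).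
  by move=> j; apply/ltW/He; rewrite addrAC subrr add0r.
exists (v + theta *: (x0 + d - v)); split.
- by apply: X_convex => //; rewrite (ltW theta0).
- rewrite mulmxDr -scalemxAr mulmxBr mulmxDr Ad Ax0.
  rewrite (_ : b + _ - _ = theta^-1 *: s); last first.
    by rewrite addrCA subrKC addrK.
  by rewrite scalerA divff ?scale1r ?lt0r_neq0// /s addrC subrK.
rewrite addrAC subrr add0r enormZ gtr0_norm//.
rewrite /theta -!mulrA ler_wpM2l// ler_wpM2l ?(ltW C0)// ler_wpM2l ?invr_ge0 ?(ltW e0)//.
rewrite mulrC ler_wpM2r ?enorm_ge0//.
rewrite addrAC; apply: le_trans (enormD _ _) _; apply: lerD (ltW d_lt).
by rewrite (le_trans (enormD _ _))// enormN lerD// HD.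
Qed.

(** Each variational inequality only tests points with its own image under [A]. Replacing the other
    solution by a nearby feasible point with that image costs a multiple of the difference of the
    images; adding both inequalities, strong monotonicity bounds the squared distance. *)
Lemma vi_sol_holder : Lf < p -> exists C rho : R, [/\ 0 <= C, 0 < rho &
  forall z x x', X z -> vi_sol z x -> vi_sol z x' ->
  enorm (A *m x - b) <= rho -> enorm (A *m x' - b) <= rho ->
  enorm (x - x') ^+ 2 <= C * enorm (A *m x - A *m x')].
Proof.
move=> p_gt_Lf; have [C [rho [C0 rho0 lift]]] := feasible_lift.
have [M M0 HM] := pgrad_bounded.
have pL : 0 < p - Lf by rewrite subr_gt0.
exists (2 * (M * C) / (p - Lf)), rho; split=> //.
  by rewrite divr_ge0 ?(ltW pL)// !mulr_ge0.
move=> z x x' zX [xX xvi] [x'X x'vi] xb x'b.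
have key y y' : X y -> X y' -> (forall v, X v -> A *m v = A *m y ->
    0 <= dot (pgrad z y) (v - y)) -> enorm (A *m y - b) <= rho ->
    enorm (A *m y' - b) <= rho ->
    dot (pgrad z y) (y - y') <= M * (C * enorm (A *m y - A *m y')).
  move=> yX y'X yvi yb y'b.
  have [w [wX Aw wy']] := lift y' y y'X y'b yb.
  have -> : y - y' = (w - y') - (w - y) by rewrite opprB [RHS]addrC addrA subrK.
  rewrite [X in X <= _]dotBr lerBlDr; apply: ler_wpDr (yvi w wX Aw) _.
  apply: le_trans (dot_le_enorm _ _) _.
  by apply: ler_pM; rewrite ?enorm_ge0 ?HM.
have H1 := key x x' xX x'X xvi xb x'b.
have H2 : dot (pgrad z x') (x' - x) <= M * (C * enorm (A *m x - A *m x')).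
  by rewrite [X in _ * (_ * X)]enormBC; exact: key.
have H3 := pgrad_strongly_monotone z xX x'X.
have H4 : dot (pgrad z x - pgrad z x') (x - x') =
    dot (pgrad z x) (x - x') + dot (pgrad z x') (x' - x).
  by rewrite dotBl -(opprB x x') dotNr.
rewrite mulrAC ler_pdivlMr// mulrC.
move: H1 H2 H3; rewrite H4; gen_norms; lra.
Qed.

(** * Quadratic terms, the augmented Lagrangian and existence of minimizers *)

Section Quadratic.
Context (k : nat) (B : 'M[R]_(k, n)) (q y : 'cV[R]_k) (gamma r : R) (z : 'cV[R]_n).

(** Besides the quadratic part of [Kfun], special parameters yield squared distances and squared
    residuals, so one gradient computation serves all of them. *)
Definition quad x : R := dot y (B *m x - q) + gamma / 2 * enorm (B *m x - q) ^+ 2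
  + r / 2 * enorm (x - z) ^+ 2.

Lemma quad_diff x : differentiable quad x /\
  grad quad x = B^T *m (y + gamma *: (B *m x - q)) + r *: (x - z).
Proof.
have [C C0 HC] := mulmx_bounded B.
apply: (diff_quadratic (C := `|gamma / 2| * C ^+ 2 + `|r / 2|)) => v.
rewrite (_ : _ - _ = gamma / 2 * enorm (B *m v) ^+ 2 + r / 2 * enorm v ^+ 2).
  apply: le_trans (ler_normD _ _) _; rewrite (normrM (gamma / 2)) (normrM (r / 2)) mulrDl.
  rewrite !(ger0_norm (sqr_ge0 (enorm _))) lerD// -mulrA ler_wpM2l// -exprMn.
  by rewrite lerXn2r ?nnegrE ?enorm_ge0 ?mulr_ge0 ?enorm_ge0.
rewrite /quad [B *m (x + v)]mulmxDr (addrAC (B *m x)) (addrAC x).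
have -> : dot (B^T *m (y + gamma *: (B *m x - q)) + r *: (x - z)) v =
    dot y (B *m v) + gamma * dot (B *m x - q) (B *m v) + r * dot (x - z) v.
  rewrite [LHS]dotDl (dotZl r) dot_mulmx trmxK; congr (_ + _).
  by rewrite [LHS]dotDl (dotZl gamma).
move: (B *m x - q) (B *m v) (x - z) => s a d.
rewrite !enorm_sqr !dotDr !dotDl (dotC a s) (dotC v d); gen_norms; lra.
Qed.

Lemma quad_continuous : continuous quad.
Proof. by move=> x; apply: differentiable_continuous; exact: (quad_diff x).1. Qed.

End Quadratic.

Lemma Kfun_quad (gamma : R) (y : 'cV[R]_m) z :
  (fun x => Kfun A b f gamma p x z y) = f \+ quad A b y gamma p z.
Proof. by apply/funext => x; rewrite /Kfun /quad /= !addrA. Qed.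

Lemma Kfun_diff (gamma : R) (y : 'cV[R]_m) z x :
  differentiable (fun x => Kfun A b f gamma p x z y) x /\
  grad (fun x => Kfun A b f gamma p x z y) x =
    pgrad z x + A^T *m (y + gamma *: (A *m x - b)).
Proof.
have [dq gq] := quad_diff A b y gamma p z x.
have df := f_smooth.1 x.
rewrite Kfun_quad; split; first exact: differentiableD.
have -> : grad (f \+ quad A b y gamma p z) x = grad f x + grad (quad A b y gamma p z) x.
  by apply/matrixP => i j; rewrite !mxE diffD.
by rewrite gq /pgrad addrAC -addrA.
Qed.

Lemma Kfun_continuous (gamma : R) (y : 'cV[R]_m) z :
  continuous (fun x => Kfun A b f gamma p x z y).
Proof. by move=> x; apply: differentiable_continuous; exact: (Kfun_diff gamma y z x).1. Qed.

Lemma prox_Kfun z :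
  (fun x => f x + p / 2 * enorm (x - z) ^+ 2) = (fun x => Kfun A b f 0 p x z 0).
Proof. by apply/funext => x; rewrite /Kfun dot0l !mul0r !addr0. Qed.

(** The multiplier and penalty terms contribute a vector in the range of [A^T], orthogonal to
    [v - u] when [v] and [u] have the same image. *)
Lemma vi_sol_argmin_Kfun gamma (y : 'cV[R]_m) z u :
  is_argmin X (fun x => Kfun A b f gamma p x z y) u -> vi_sol z u.
Proof.
move=> uK; split=> [|v vX Av]; first exact: uK.1.
have [dK gK] := Kfun_diff gamma y z u.
have := argmin_first_order X_convex dK uK vX; rewrite gK dotDl dot_mulmx trmxK.
by rewrite mulmxBr Av subrr dot0r addr0.
Qed.

Lemma closed_affine (q : 'cV[R]_m) : closed [set x : 'cV[R]_n | A *m x = q].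
Proof.
(* The affine set is the zero set of the squared residual. *)
have -> : [set x : 'cV[R]_n | A *m x = q] = quad A q 0 2 0 0 @^-1` [set 0].
  apply/seteqP; split=> x /=; rewrite /quad dot0l !mul0r addr0 add0r divff// mul1r.
    by move=> ->; rewrite subrr enorm0 expr0n.
  by move=> /eqP; rewrite sqrf_eq0 enorm_eq0 subr_eq0 => /eqP.
apply: preimage_closed; last exact: closed_eq.
by move=> x _; exact: quad_continuous.
Qed.

Lemma prox_argmin (q : 'cV[R]_m) z : (exists2 v, X v & A *m v = q) ->
  let D := X `&` [set x | A *m x = q] in
  let g := (fun x => f x + p / 2 * enorm (x - z) ^+ 2) in
  vi_sol z (argmin D g) /\ A *m argmin D g = q.
Proof.
move=> [v vX Av] D g.
have Dg : is_argmin D g (argmin D g).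
  apply: argmin_is_argmin; first by exists v.
    by apply: compact_closedI => //; exact: closed_affine.
  by rewrite /g prox_Kfun; exact: Kfun_continuous.
have [[uX Au] _] := Dg; split=> //; split=> // w wX Aw.
have Dconv : segment_closed D.
  move=> w1 w2 t [w1X Aw1] [w2X Aw2] t01; split; first exact: X_convex.
  by rewrite /= mulmxDr -scalemxAr mulmxBr Aw1 Aw2 subrr scaler0 addr0.
have [dK gK] := Kfun_diff 0 0 z (argmin D g).
rewrite -prox_Kfun -/g in dK gK.
have Dw : D w by split=> //=; rewrite Aw.
have := argmin_first_order Dconv dK Dg Dw.
by rewrite gK scale0r addr0 mulmx0 addr0.
Qed.

(** * Projection and the error bound for a projected gradient step *)

Lemma proj_obtuse v w : X w ->
  X (proj X v) /\ 0 <= dot (proj X v - v) (w - proj X v).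
Proof.
move=> wX.
(* The squared distance, obtained from an empty matrix, is differentiable everywhere and has the
   same minimizers as the distance. *)
pose g := quad (0 : 'M[R]_(0, n)) 0 0 0 2 v.
have gE u : g u = enorm (u - v) ^+ 2.
  by rewrite /g /quad dot0l !mul0r !add0r divff// mul1r.
have gproj u : is_argmin X g u <-> is_argmin X (fun u => enorm (u - v)) u.
  split=> -[uX Hu]; split=> // u' u'X; have := Hu u' u'X.
    by rewrite !gE ler_pXn2r ?nnegrE ?enorm_ge0.
  by rewrite !gE ler_pXn2r ?nnegrE ?enorm_ge0.
have : is_argmin X (fun u => enorm (u - v)) (proj X v).
  apply: xgetPex; exists (argmin X g); apply/gproj.
  by apply: argmin_is_argmin => //; [exists w|exact: quad_continuous].
move=> /gproj Hp; split; first exact: Hp.1.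
have [dg gg] := quad_diff (0 : 'M[R]_(0, n)) 0 0 0 2 v (proj X v).
have := argmin_first_order X_convex dg Hp wX.
by rewrite gg trmx0 mul0mx add0r dotZl pmulr_rge0.
Qed.

(** The projection inequality tested at [u] is added to [c] times the variational inequality of [u]
    tested at the projected point; strong monotonicity and Lipschitz continuity of [F] then allow
    division by [enorm (x - u)]. *)
Lemma projected_step_error (F : 'cV[R]_n -> 'cV[R]_n) (c s L : R) x u :
  0 < c -> 0 < s -> 0 <= L -> X u ->
  (forall v, X v -> 0 <= dot (F u) (v - u)) ->
  s * enorm (x - u) ^+ 2 <= dot (F x - F u) (x - u) ->
  enorm (F x - F u) <= L * enorm (x - u) ->
  enorm (x - u) <= (1 + c * L) / (c * s) * enorm (x - proj X (x - c *: F x)).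
Proof.
move=> c0 s0 L0 uX uvi Fmono Flip.
have [x'X Hx'] := proj_obtuse (x - c *: F x) uX.
set x' := proj _ _ in x'X Hx' *.
have [xu0|xu0] := eqVneq (enorm (x - u)) 0.
  rewrite [X in X <= _]xu0 mulr_ge0 ?enorm_ge0// divr_ge0 ?addr_ge0 ?mulr_ge0// ltW//.
have xu_gt0 : 0 < enorm (x - u) by rewrite lt_neqAle enorm_ge0 eq_sym xu0.
have cs0 : 0 < c * s by rewrite mulr_gt0.
have key : c * dot (F x - F u) (x - u) <=
    enorm (x - x') * enorm (x - u) + c * (enorm (F x - F u) * enorm (x - x')).
  have Hu := uvi x' x'X.
  have e1 : u - x' = (x - x') - (x - u) by rewrite opprB [RHS]addrC addrA subrK.
  have e2 : x' - u = (x - u) - (x - x') by rewrite opprB [RHS]addrC addrA subrK.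
  have e3 : x' - (x - c *: F x) = c *: F x - (x - x').
    by rewrite !opprB addrCA addrA.
  rewrite e3 e1 in Hx'; rewrite e2 in Hu.
  have H1 := dot_le_enorm (x - x') (x - u).
  have H2 := ler_wpM2l (ltW c0) (dot_le_enorm (F x - F u) (x - x')).
  have H3 := dot_ge0 (x - x').
  move: Hx' (mulr_ge0 (ltW c0) Hu) H1 H2 H3.
  move: (x - x') (x - u) => e d.
  by rewrite !dotBr !dotBl !dotZl; gen_norms; lra.
rewrite mulrAC ler_pdivlMr//.
have := ler_wpM2l (ltW c0) Fmono.
have := ler_wpM2l (ltW c0) (ler_wpM2r (enorm_ge0 (x - x')) Flip).
have := enorm_ge0 (x - x'); move: key xu_gt0.
gen_norms; nra.
Qed.

(** * Multipliers and stationarity of limit points *)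

Definition kkt_pair z x (lam : 'cV[R]_(m + l)) : Prop :=
  [/\ X x, pgrad z x + (Qmx A h x)^T *m lam = 0,
      forall j, 0 <= lam (rshift m j) ord0,
      csupp lam \subset active h x &
      row_free (Qsub A h (csupp lam) x)].

Let h_diff j x : differentiable (h j) x := (h_smooth j).1 x.

Lemma enorm_usubmx (lam : 'cV[R]_(m + l)) : enorm (usubmx lam) <= enorm lam.
Proof.
rewrite ler_wsqrtr// {2}/dot big_split_ord/= -[X in X <= _]addr0 lerD//.
  by rewrite /dot ler_sum// => i _; rewrite !mxE.
by apply: sumr_ge0 => i _; rewrite -expr2 sqr_ge0.
Qed.

(** By convexity, the gradient of an active constraint makes a nonpositive product with [u - x], so
    only the equality rows remain in the upper bound. *)
Lemma multiplier_ineq x u (lam : 'cV[R]_(m + l)) : X u ->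
  (forall j, 0 <= lam (rshift m j) ord0) -> csupp lam \subset active h x ->
  dot ((Qmx A h x)^T *m lam) (u - x) <= dot (usubmx lam) (A *m (u - x)).
Proof.
move=> uX lam0 lamact.
rewrite trQmx_mul dot_suml big_split_ord/= -[X in _ <= X]addr0; apply: lerD.
  apply: ler_sum => i _.
  by rewrite dotZl Qrow_lshift dot_row [usubmx lam i ord0]mxE.
apply: sumr_le0 => j _; rewrite dotZl Qrow_rshift.
have [->|lamj] := eqVneq (lam (rshift m j) ord0) 0; first by rewrite mul0r.
have : rshift m j \in csupp lam by rewrite inE.
move=> /(fintype.subsetP lamact); rewrite active_rshift => /eqP hx0.
rewrite mulr_ge0_le0//.
apply: le_trans (convex_gradient_ineq u (h_convex j) (h_diff j x)) _.
by rewrite hx0 subr0; exact: uX.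
Qed.

Lemma stationary_of_vi x : X x -> A *m x = b ->
  (forall v, X v -> A *m v = b -> 0 <= dot (grad f x) (v - x)) ->
  stationary_set A b f h x.
Proof.
move=> xX Ax xvi; split=> //.
have [x0 [Ax0 hx0]] := slater_cond.
have [||lam [lamG lam0 lamact _]] := kkt (A := A) (G := grad f x) h_diff h_convex xX.
- by exists x0; rewrite Ax.
- by move=> v vX; rewrite Ax; exact: xvi.
(* The subgradient is the contribution of the inequality constraints; [multiplier_ineq] is its
   normal cone inequality. *)
exists (usubmx lam), ((Qmx A h x)^T *m lam - A^T *m usubmx lam); split; last first.
  by rewrite -addrA subrKC.
move=> u; rewrite /cvx_indic mem_set//.
have [uX|uX] := boolP (u \in constr_set h); last by rewrite leey.
rewrite add0e lee_fin dotBl subr_le0 [X in _ <= X]dot_mulmx trmxK.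
exact: multiplier_ineq (set_mem uX) lam0 lamact.
Qed.

Lemma le0_of_small (a K r : R) : 0 < r ->
  (forall e, 0 < e -> e <= r -> a <= K * e) -> a <= 0.
Proof.
move=> r0 H; rewrite leNgt; apply/negP => a0.
pose e := Num.min r (a / (2 * (`|K| + 1))).
have K0 : 0 < 2 * (`|K| + 1) by rewrite mulr_gt0// ltr_wpDl.
have e0 : 0 < e by rewrite lt_min r0 divr_gt0.
have er : e <= r by rewrite ge_min lexx.
have : e <= a / (2 * (`|K| + 1)) by rewrite ge_min lexx orbT.
rewrite ler_pdivlMr// => eK; have := H e e0 er; have := ler_norm K.
by nra.
Qed.

(** A test point [v] with image [b] is lifted to a nearby [w] with the image of [u], where the
    inequality for [u] applies. As [u] is close to [z], the proximal term is small as well, and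
    every error is of order [e]. *)
Lemma stationary_of_vi_limit x : X x ->
  (forall rho, 0 < rho -> exists z u, [/\ X z, vi_sol z u, enorm (u - x) <= rho,
     enorm (u - z) <= rho & enorm (A *m u - b) <= rho]) ->
  stationary_set A b f h x.
Proof.
move=> xX H.
have Ax : A *m x = b.
  have [C C0 HC] := mulmx_bounded A.
  apply/eqP; rewrite -subr_eq0 -enorm_eq0 eq_le enorm_ge0 andbT.
  apply: (@le0_of_small _ (C + 1) 1) => // e e0 _.
  have [z [u [_ _ ux _ ub]]] := H e e0.
  have -> : A *m x - b = A *m (x - u) + (A *m u - b).
    by rewrite mulmxBr addrA subrK.
  rewrite mulrDl mul1r (le_trans (enormD _ _))// lerD//.
  by rewrite (le_trans (HC _))// ler_wpM2l// enormBC.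
apply: stationary_of_vi => // v vX Av.
have [C [rho [C0 rho0 lift]]] := feasible_lift.
have [M M0 HM] := pgrad_bounded.
rewrite -oppr_le0.
pose K := M * (C + 1) + (`|Lf| + `|p|) * enorm (v - x).
apply: (@le0_of_small _ K rho) => // e e0 erho.
have [z [u [zX [uX uvi] ux uz ub]]] := H e e0.
have [||w [wX Aw wv]] := lift v u vX.
- by rewrite Av subrr enorm0 ltW.
- exact: le_trans erho.
have Hw := uvi w wX Aw.
have {}wv : enorm (w - v) <= C * e.
  by rewrite (le_trans wv)// Av ler_wpM2l.
have Hg : enorm (pgrad z u - grad f x) <= (`|Lf| + `|p|) * e.
  rewrite /pgrad addrAC mulrDl (le_trans (enormD _ _))// lerD//; last first.
    by rewrite enormZ ler_wpM2l.
  rewrite (le_trans (f_grad_lipschitz uX xX))//.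
  rewrite (@le_trans _ _ (`|Lf| * enorm (u - x)))// ?ler_wpM2l//.
  by rewrite ler_wpM2r ?enorm_ge0// ler_norm.
have E1 : dot (pgrad z u) (v - x) =
    dot (pgrad z u) (w - u) - dot (pgrad z u) (w - v) - dot (pgrad z u) (x - u).
  by rewrite !dotBr; gen_norms; lra.
have E2 := dotBl (pgrad z u) (grad f x) (v - x).
have H1 := dot_le_enorm (pgrad z u) (w - v).
have H2 := dot_le_enorm (pgrad z u) (x - u).
have H3 := dot_le_enorm (pgrad z u - grad f x) (v - x).
have H4 : enorm (pgrad z u) * enorm (w - v) <= M * (C * e).
  by apply: ler_pM; rewrite ?enorm_ge0 ?HM.
have H5 : enorm (pgrad z u) * enorm (x - u) <= M * e.
  by apply: ler_pM; rewrite ?enorm_ge0 ?HM// enormBC.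
have H6 := ler_wpM2r (enorm_ge0 (v - x)) Hg.
move: E1 E2 Hw H1 H2 H3 H4 H5 H6; rewrite /K; gen_norms; lra.
Qed.

Lemma vi_sol_kkt_pair : exists2 rho : R, 0 < rho &
  forall z x, vi_sol z x -> enorm (A *m x - b) <= rho ->
  exists lam, kkt_pair z x lam.
Proof.
have [rho rho0 Hrho] := strictly_feasible_lift.
exists rho => // z x [xX xvi] xb.
have [lam [lamG lam0 lamact lamfree]] := kkt h_diff h_convex xX (Hrho x xb) xvi.
by exists lam.
Qed.

(** * Lipschitz stability under constant rank, first local, then uniform *)

Hypothesis h_grad_lipschitz : forall i, grad_lipschitz_on setT Lh (h i).

Definition constant_rank_at x : Prop :=
  forall S : {set 'I_(m + l)}, S != finset.set0 -> S \subset active h x ->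
  exists r : nat, \forall u \near x, \rank (Qsub A h S u) = r.

(** With a common support, the difference of the multipliers obeys the bound of
    [crcq_multiplier_bound], so it is of order [enorm (x - x')]. Strong monotonicity with
    [multiplier_ineq] both ways bounds the squared distance by this difference times that of the
    images, and one factor cancels. *)
Lemma same_support_lipschitz xb : Lf < p -> constant_rank_at xb ->
  exists rho K : R, [/\ 0 < rho, 0 <= K &
  forall z x x' lam lam', X z -> kkt_pair z x lam -> kkt_pair z x' lam' ->
    csupp lam = csupp lam' -> enorm (x - xb) < rho -> enorm (x' - xb) < rho ->
    enorm (x - x') <= K * enorm (A *m x - A *m x')].
Proof.
move=> p_gt_Lf cr.
have h_cont j : continuous (h j).
  by move=> x; exact: differentiable_continuous.
have [rho [kap [rho0 kap0 Hkap]]] := crcq_multiplier_bound h_cont h_grad_lipschitz cr.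
have [M M0 HM] := pgrad_bounded.
have pL : 0 < p - Lf by rewrite subr_gt0.
(* The first two terms come from the variation of [pgrad], the last from that of the constraint
   gradients against a multiplier of norm at most [kap * M]. *)
pose K1 := kap * (`|Lf| + `|p| + l%:R * `|Lh| * (kap * M)).
have K10 : 0 <= K1 by rewrite mulr_ge0// !addr_ge0// !mulr_ge0.
exists rho, (K1 / (p - Lf)); split=> //; first by rewrite divr_ge0// ltW.
move=> z x x' lam lam' zX [xX xG lam0 lamact lamfree].
move=> [x'X x'G lam'0 lam'act lam'free] lamE xxb x'xb.
have Glam : pgrad z x = - ((Qmx A h x)^T *m lam).
  by apply/eqP; rewrite -addr_eq0 xG.
have Glam' : pgrad z x' = - ((Qmx A h x')^T *m lam').
  by apply/eqP; rewrite -addr_eq0 x'G.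
have lam'M : enorm lam' <= kap * M.
  have := Hkap x' (csupp lam') lam' x'xb lam'act lam'free (fintype.subxx _).
  move=> /le_trans; apply; rewrite ler_wpM2l// -enormN -Glam'; exact: HM.
have vec (q1 q2 q3 g g' : 'cV[R]_n) : g = - q1 -> g' = - q3 ->
    q1 - q2 = - (g - g') - (q2 - q3).
  by move=> -> ->; rewrite opprK opprD opprK opprB addrA subrK.
have dlam : enorm (lam - lam') <= K1 * enorm (x - x').
  have supp : csupp (lam - lam') \subset csupp lam.
    apply/fintype.subsetP => i; rewrite !inE !mxE; apply: contra => /eqP li.
    have : i \notin csupp lam' by rewrite -lamE inE li eqxx.
    by rewrite inE negbK li => /eqP ->; rewrite subr0.
  have := Hkap x (csupp lam) (lam - lam') xxb lamact lamfree supp.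
  move=> /le_trans; apply; rewrite /K1 -mulrA ler_wpM2l//.
  rewrite [X in enorm X <= _](_ : _ = - (pgrad z x - pgrad z x') -
      ((Qmx A h x)^T *m lam' - (Qmx A h x')^T *m lam')); last first.
    exact: etrans (mulmxBr _ _ _) (vec _ _ _ _ _ Glam Glam').
  apply: le_trans (enormD _ _) _; rewrite mulrDl lerD//.
    by rewrite enormN; exact: pgrad_lipschitz.
  rewrite enormN; apply: le_trans (trQmx_lipschitz A h_grad_lipschitz x x' lam') _.
  rewrite mulrAC ler_wpM2r ?enorm_ge0//.
  by rewrite ler_wpM2l// mulr_ge0.
have H1 : (p - Lf) * enorm (x - x') ^+ 2 <= dot (usubmx (lam - lam')) (A *m x' - A *m x).
  apply: le_trans (pgrad_strongly_monotone z xX x'X) _.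
  have Hx := multiplier_ineq x'X lam0 lamact.
  have Hx' := multiplier_ineq xX lam'0 lam'act.
  have bil k (g g' v v' : 'cV[R]_k) :
      dot (g - g') (v - v') = - (dot g (v' - v) + dot g' (v - v')).
    by rewrite !dotBl !dotBr; gen_norms; lra.
  have -> : usubmx (lam - lam') = usubmx lam - usubmx lam'.
    by apply/matrixP => i j; rewrite !mxE.
  rewrite [X in X <= _]bil [X in _ <= X]bil -!mulmxBr [X in - (X + _) <= _](_ : _ =
    - dot ((Qmx A h x)^T *m lam) (x' - x)); last by rewrite [X in dot X]Glam dotNl.
  rewrite [X in - (_ + X) <= _](_ : _ = - dot ((Qmx A h x')^T *m lam') (x - x'));
    last by rewrite [X in dot X]Glam' dotNl.
  rewrite -opprD opprK [X in _ <= - (X + _)](_ : _ =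
    - dot (usubmx lam) (A *m (x' - x))); last by rewrite -(opprB x' x) mulmxN dotNr.
  rewrite [X in _ <= - (_ + X)](_ : _ =
    - dot (usubmx lam') (A *m (x - x'))); last by rewrite -(opprB x x') mulmxN dotNr.
  by rewrite -opprD opprK lerD.
have H2 : dot (usubmx (lam - lam')) (A *m x' - A *m x) <=
    K1 * enorm (x - x') * enorm (A *m x - A *m x').
  apply: le_trans (dot_le_enorm _ _) _; rewrite [X in _ * X <= _]enormBC.
  by rewrite ler_wpM2r ?enorm_ge0// (le_trans (enorm_usubmx _)).
have [->|xx0] := eqVneq (enorm (x - x')) 0.
  by rewrite mulr_ge0 ?enorm_ge0// divr_ge0// ltW.
have xx_gt0 : 0 < enorm (x - x') by rewrite lt_neqAle enorm_ge0 eq_sym xx0.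
rewrite mulrAC ler_pdivlMr// -(ler_pM2r xx_gt0).
move: H1 H2; gen_norms; lra.
Qed.

Lemma vi_sol_unique z x x' : Lf < p -> vi_sol z x -> vi_sol z x' ->
  A *m x = A *m x' -> x = x'.
Proof.
move=> p_gt_Lf [xX xvi] [x'X x'vi] Axx.
have pL : 0 < p - Lf by rewrite subr_gt0.
have H1 := xvi x' x'X (esym Axx); have H2 := x'vi x xX Axx.
have bil (g g' v v' : 'cV[R]_n) :
    dot (g - g') (v - v') = - (dot g (v' - v) + dot g' (v - v')).
  by rewrite !dotBl !dotBr; gen_norms; lra.
have := pgrad_strongly_monotone z xX x'X; rewrite [X in _ <= X]bil => H3.
have : enorm (x - x') ^+ 2 <= 0.
  rewrite -(pmulr_rle0 _ pL) (le_trans H3)// oppr_le0; exact: addr_ge0.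
rewrite le_eqVlt ltNge sqr_ge0 orbF sqrf_eq0 enorm_eq0 subr_eq0.
by move/eqP.
Qed.

(** [labelled_chain] is applied to the solutions with images [b + (k / N) *: r], labelled by
    multiplier supports. The error from elementary steps is a fixed number of labels times [e], and
    [e] is arbitrary. *)
Lemma vi_sol_local_lipschitz xb : Lf < p -> constant_rank_at xb ->
  exists rho K : R, [/\ 0 < rho, 0 <= K &
  forall z u w, X z -> vi_sol z u -> vi_sol z w -> A *m w = b ->
    enorm (u - xb) <= rho -> enorm (A *m u - b) <= rho ->
    enorm (u - w) <= K * enorm (A *m u - b)].
Proof.
move=> p_gt_Lf cr.
have [C [rho1 [C0 rho1_gt0 holder]]] := vi_sol_holder p_gt_Lf.
have [rho2 rho2_gt0 Hkkt] := vi_sol_kkt_pair.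
have [rho3 [K [rho3_gt0 K0 Hsame]]] := same_support_lipschitz p_gt_Lf cr.
(* Hoelder continuity then keeps all intermediate solutions within [rho3 / 2] of [u], and [u] is
   within [rho3 / 4] of [xb]. *)
pose rho4 := rho3 ^+ 2 / (8 * (C + 1)).
have C1 : 0 < 8 * (C + 1) by rewrite mulr_gt0// ltr_wpDl.
have rho4_gt0 : 0 < rho4 by rewrite divr_gt0// exprn_gt0.
pose rho := Num.min (Num.min rho1 rho2) (Num.min (rho3 / 4) rho4).
have rho_gt0 : 0 < rho by rewrite !lt_min rho1_gt0 rho2_gt0 rho4_gt0 divr_gt0.
have [le1 le2 le3 le4] : [/\ rho <= rho1, rho <= rho2, rho <= rho3 / 4 & rho <= rho4].
  by split; rewrite !ge_min lexx ?orbT.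
exists rho, K; split=> // z u w zX uvi wvi Aw uxb ub.
pose r := A *m u - b.
have r_le : enorm r <= rho by [].
have near_u x (s : R) : vi_sol z x -> A *m x = b + s *: r -> 0 <= s <= 1 ->
    enorm (A *m x - b) <= rho /\ enorm (x - xb) < rho3.
  move=> xvi Ax /andP[s0 s1].
  have xr : enorm (A *m x - b) <= rho.
    rewrite Ax addrAC subrr add0r enormZ ger0_norm// (le_trans _ r_le)//.
    by rewrite ler_piMl ?enorm_ge0.
  split=> //.
  have H1 := holder z x u zX xvi uvi (le_trans xr le1) (le_trans ub le1).
  have H2 : enorm (A *m x - A *m u) <= rho.
    rewrite Ax (_ : _ - _ = (s - 1) *: r); last first.
      have rE : - r = b - A *m u by rewrite /r opprB.
      by rewrite scalerBl scale1r rE addrCA addrA.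
    rewrite enormZ ler0_norm ?subr_le0// opprB (le_trans _ r_le)//.
    by rewrite ler_piMl ?enorm_ge0// gerBl.
  have H3 : enorm (x - u) <= rho3 / 2.
    rewrite -(ler_pXn2r (ltn0Sn 1)) ?nnegrE ?enorm_ge0 ?divr_ge0 ?(ltW rho3_gt0)//.
    have H4 : rho4 * (8 * (C + 1)) = rho3 ^+ 2 by rewrite divfK// lt0r_neq0.
    have := ler_wpM2l C0 (le_trans H2 le4).
    move: H1 H4 (mulr_ge0 C0 (ltW rho4_gt0)) (ltW rho4_gt0); gen_norms; lra.
  move: (enorm_tri x u xb) H3 uxb le3 rho3_gt0; gen_norms; lra.
(* Consecutive solutions have squared distance at most [C * enorm r / N], so this condition on [N]
   makes each elementary step at most [e]. *)
suff key N : (0 < N)%N -> forall e, 0 < e -> C * enorm r <= e ^+ 2 * N%:R ->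
    enorm (w - u) <= K * enorm r + #|{set 'I_(m + l)}|%:R * e.
  rewrite enormBC -subr_le0.
  apply: (@le0_of_small _ #|{set 'I_(m + l)}|%:R 1) => // e e0 _.
  rewrite lerBlDl; pose B := C * enorm r / e ^+ 2.
  have B0 : 0 <= B by rewrite divr_ge0 ?sqr_ge0// mulr_ge0 ?enorm_ge0.
  apply: (key (Num.bound B).+1) => //.
  rewrite [X in _ <= X]mulrC -ler_pdivrMr ?exprn_gt0//.
  by apply: le_trans (ltW (archi_boundP B0)) _; rewrite ler_nat.
move=> N0 e e0 Ne.
have NR0 : 0 < N%:R :> R by rewrite ltr0n.
pose s k : R := k%:R / N%:R.
have s01 k : (k <= N)%N -> 0 <= s k <= 1.
  by move=> kN; rewrite divr_ge0//= ler_pdivrMr// mul1r ler_nat.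
have /choice[xl Hxl] : forall k, exists xl : 'cV[R]_n * 'cV[R]_(m + l), (k <= N)%N ->
    [/\ vi_sol z xl.1, A *m xl.1 = b + s k *: r & kkt_pair z xl.1 xl.2].
  move=> k.
  have [kN|kN] := boolP (k <= N)%N; last by exists (0, 0) => kN'; case/negP: kN.
  have [|xvi Ax] := @prox_argmin (b + s k *: r) z.
    exists (w + s k *: (u - w)); first by apply: X_convex; [exact: wvi.1|exact: uvi.1|exact: s01].
    by rewrite mulmxDr -scalemxAr mulmxBr Aw.
  set x := argmin _ _ in xvi Ax.
  have [lam Hlam] := Hkkt z x xvi (le_trans (near_u x (s k) xvi Ax (s01 k kN)).1 le2).
  by exists (x, lam).
have dA i j : (i <= N)%N -> (j <= N)%N ->
    enorm (A *m (xl i).1 - A *m (xl j).1) = `|s i - s j| * enorm r.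
  move=> iN jN; have [_ -> _] := Hxl i iN; have [_ -> _] := Hxl j jN.
  by rewrite opprD addrACA subrr add0r -scalerBl enormZ.
(* Uniqueness for a given image identifies the ends of the chain with [w] and [u]. *)
have x0w : (xl 0%N).1 = w.
  have [xvi Ax _] := Hxl 0%N (leq0n N).
  by apply: (vi_sol_unique p_gt_Lf xvi wvi); rewrite Ax Aw /s mul0r scale0r addr0.
have xNu : (xl N).1 = u.
  have [xvi Ax _] := Hxl N (leqnn N).
  apply: (vi_sol_unique p_gt_Lf xvi uvi).
  by rewrite Ax /s divff ?lt0r_neq0// scale1r /r subrKC.
have := @labelled_chain R n {set 'I_(m + l)} (fun k => (xl k).1)
  (fun k => csupp (xl k).2) (K * enorm r / N%:R) e N.
rewrite /= x0w xNu divfK ?lt0r_neq0//; apply; rewrite ?(ltW e0)//.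
- by rewrite divr_ge0// mulr_ge0 ?enorm_ge0.
- move=> i j /andP[ij jN] Sij; have iN := leq_trans ij jN.
  have [xivi Axi kkti] := Hxl i iN; have [xjvi Axj kktj] := Hxl j jN.
  have := Hsame z _ _ _ _ zX kkti kktj Sij (near_u _ _ xivi Axi (s01 i iN)).2
    (near_u _ _ xjvi Axj (s01 j jN)).2.
  rewrite dA// => /le_trans; apply.
  rewrite /s -mulrBl -[X in _ * (X * _)]normrN -mulNr opprB -natrB// ger0_norm ?divr_ge0//.
  by rewrite mulrCA mulrC mulrA mulrAC.
move=> i iN; have [xivi Axi _] := Hxl i (ltnW iN); have [xjvi Axj _] := Hxl i.+1 iN.
rewrite -(ler_pXn2r (ltn0Sn 1)) ?nnegrE ?enorm_ge0 ?(ltW e0)//.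
apply: le_trans (holder z _ _ zX xivi xjvi _ _) _.
- exact: le_trans (near_u _ _ xivi Axi (s01 i (ltnW iN))).1 le1.
- exact: le_trans (near_u _ _ xjvi Axj (s01 i.+1 iN)).1 le1.
rewrite dA ?(ltnW iN)// /s -mulrBl -[X in C * (X * _)]normrN -mulNr opprB -natrB//.
by rewrite subSnn mul1r ger0_norm ?invr_ge0// mulrCA mulrC ler_pdivrMr.
Qed.

(** A single integer serves as Lipschitz constant and as inverse radius, so each local bound holds
    for all large integers and the covering form of compactness makes the choice uniform over X. *)
Lemma vi_sol_uniform_lipschitz : Lf < p -> CRCQ A b f h ->
  exists2 k : nat, (0 < k)%N & forall z u w, X z -> vi_sol z u -> vi_sol z w ->
    A *m w = b -> enorm (u - z) <= k%:R^-1 -> enorm (A *m u - b) <= k%:R^-1 ->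
    enorm (u - w) <= k%:R * enorm (A *m u - b).
Proof.
move=> p_gt_Lf crcq.
pose P (k : nat) u := forall z w, X z -> vi_sol z u -> vi_sol z w ->
    A *m w = b -> enorm (u - z) <= k.+1%:R^-1 -> enorm (A *m u - b) <= k.+1%:R^-1 ->
    enorm (u - w) <= k.+1%:R * enorm (A *m u - b).
have loc xb : X xb -> exists rho K : R, [/\ 0 < rho, 0 <= K &
    forall z u w, X z -> vi_sol z u -> vi_sol z w -> A *m w = b ->
    enorm (u - xb) <= rho -> enorm (u - z) <= rho -> enorm (A *m u - b) <= rho ->
    enorm (u - w) <= K * enorm (A *m u - b)].
  move=> xbX.
  have [/crcq cr|nst] := pselect (stationary_set A b f h xb).
    have [rho [K [rho0 K0 HK]]] := vi_sol_local_lipschitz p_gt_Lf cr.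
    by exists rho, K; split=> // z u w zX uvi wvi Aw uxb _; exact: (HK z).
  (* Near a nonstationary point the hypotheses are contradictory for this [rho], so the constant 0
     will do. *)
  have /existsNP[rho /not_implyP[rho0 nrho]] :=
    contra_not (stationary_of_vi_limit xbX) nst.
  exists rho, 0; split=> // z u w zX uvi wvi Aw uxb uz ub.
  by case: nrho; exists z, u.
have [N _ HN] : \forall k \near \oo, X `<=` P k.
  apply: ((compact_near_coveringP X).1 X_compact) => xb xbX.
  have [rho [K [rho0 K0 HK]]] := loc xb xbX.
  exists ([set u | enorm (u - xb) <= rho], [set k | k.+1%:R^-1 <= rho /\ K <= k.+1%:R]) => /=.
    split.
      apply/nbhs_ballP; exists (rho / (n%:R + 1)) => /=; first by rewrite divr_gt0// ltr_wpDl.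
      move=> u; rewrite -ball_normE /ball_/= distrC ltr_pdivlMr ?ltr_wpDl// => ux.
      apply: le_trans (enorm_le_mx_norm _) _; move: ux (normr_ge0 (u - xb)).
      by move: `|u - xb| => t; nra.
    exists (Num.bound rho^-1 + Num.bound K)%N => // k /= Hk; split.
      rewrite -[rho]invrK lef_pV2 ?posrE ?invr_gt0//.
      rewrite (le_trans (ltW (archi_boundP _))) ?invr_ge0 ?(ltW rho0)// ler_nat.
      by rewrite leqW// (leq_trans _ Hk)// leq_addr.
    rewrite (le_trans (ltW (archi_boundP K0)))// ler_nat.
    by rewrite leqW// (leq_trans _ Hk)// leq_addl.
  move=> [u k] /= [uxb [krho Kk]] z w zX uvi wvi Aw uz ub.
  apply: le_trans (HK z u w zX uvi wvi Aw uxb (le_trans uz krho) (le_trans ub krho)) _.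
  by rewrite ler_wpM2r ?enorm_ge0.
exists N.+1 => // z u w zX uvi; have uX := uvi.1.
exact: (HN N (leqnn N) u uX).
Qed.

Lemma grad_KfunB gamma (y : 'cV[R]_m) z x u :
  grad (fun x => Kfun A b f gamma p x z y) x -
    grad (fun x => Kfun A b f gamma p x z y) u =
  (pgrad z x - pgrad z u) + gamma *: (A^T *m (A *m (x - u))).
Proof.
rewrite (Kfun_diff gamma y z x).2 (Kfun_diff gamma y z u).2 opprD addrACA.
congr (_ + _); rewrite -mulmxBr opprD addrACA subrr add0r -scalerBr -scalemxAr.
by rewrite (mulmxBr A) opprB addrA subrK.
Qed.

(** The penalty adds a positive semidefinite linear map to the gradient and [y] a constant, so the
    monotonicity and Lipschitz moduli, and hence [C], are uniform in [y] and [z]. *)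
Lemma primal_step_error gamma (c : R) : Lf < p -> 0 <= gamma -> 0 < c ->
  exists2 C : R, 0 <= C & forall (y : 'cV[R]_m) z x u, X x ->
    is_argmin X (fun x => Kfun A b f gamma p x z y) u ->
    enorm (x - u) <= C *
      enorm (x - proj X (x - c *: grad (fun x => Kfun A b f gamma p x z y) x)).
Proof.
move=> p_gt_Lf gamma0 c0.
have pL : 0 < p - Lf by rewrite subr_gt0.
have [C C0 HC] := mulmx_bounded A.
have [C' C'0 HC'] := mulmx_bounded A^T.
pose L := `|Lf| + `|p| + gamma * (C' * C).
have L0 : 0 <= L by rewrite !addr_ge0// !mulr_ge0.
exists ((1 + c * L) / (c * (p - Lf))).
  by rewrite divr_ge0 ?addr_ge0// ?mulr_ge0// ltW.
move=> y z x u xX uK; have uX := uK.1.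
apply: (@projected_step_error (grad (fun x => Kfun A b f gamma p x z y)) c _ L) => //.
- by apply: argmin_first_order => //; exact: (Kfun_diff gamma y z u).1.
- rewrite grad_KfunB [X in _ <= X]dotDl dotZl [X in _ + _ * X]dot_mulmx trmxK.
  apply: ler_wpDr (pgrad_strongly_monotone z xX uX).
  by rewrite mulr_ge0// dot_ge0.
rewrite grad_KfunB; apply: le_trans (enormD _ _) _; rewrite mulrDl; apply: lerD.
  exact: pgrad_lipschitz.
rewrite enormZ ger0_norm// -mulrA ler_wpM2l//.
by rewrite (le_trans (HC' _))// -mulrA ler_wpM2l.
Qed.

End PerturbedProgram.

(** * The error bound along the iterates of the algorithm *)

Theorem lemma8 (R : realType) (n m l : nat)
  (A : 'M[R]_(m, n)) (b : 'cV[R]_m)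
  (f : 'cV[R]_n -> R) (h : 'I_l -> 'cV[R]_n -> R)
  (Lf Lh gamma p alpha beta c : R)
  (x : nat -> 'cV[R]_n) (y : nat -> 'cV[R]_m) (z : nat -> 'cV[R]_n)
  (f_smooth : smooth f)
  (X_compact : compact (constr_set h))
  (X_convex : convex_set (constr_set h))
  (f_bounded_below : exists lb : R, forall u, constr_set h u -> lb <= f u)
  (f_grad_lipschitz : grad_lipschitz_on (constr_set h) Lf f)
  (h_smooth : forall i, smooth (h i))
  (h_convex : forall i, convex_function setT (h i))
  (h_grad_lipschitz : forall i, grad_lipschitz_on setT Lh (h i))
  (slater_cond : slater A b h)
  (crcq : CRCQ A b f h)
  (gamma_ge0 : 0 <= gamma) (p_gt_Lf : Lf < p) (p_gt0 : 0 < p)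
  (alpha_gt0 : 0 < alpha) (beta_gt0 : 0 < beta) (beta_le1 : beta <= 1)
  (c_gt0 : 0 < c)
  (xyz_spalm : spalm A b f h gamma p alpha beta c x y z) :
  exists delta sigma_s : R, [/\ 0 < delta, 0 < sigma_s &
    forall t : nat,
      let xyz := x_yz A b f h gamma p (y t.+1) (z t) in
      Num.max (Num.max (enorm (x t - x t.+1)) (enorm (A *m xyz - b)))
              (enorm (z t - x t.+1)) <= delta ->
      enorm (xyz - x_z A b f h p (z t)) <= sigma_s * enorm (A *m xyz - b)].
Proof.
have Xseg := convex_set_segment X_convex.
have [x0s [Ax0 hx0]] := slater_cond.
have x0X : constr_set h x0s by move=> j; exact: ltW.
have [x0_in z0_in step] := xyz_spalm.
have xX t : constr_set h (x t).
  case: t => // t; have [_ -> _] := step t.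
  exact: (proj_obtuse X_compact Xseg _ x0X).1.
have zX t : constr_set h (z t).
  elim: t => // t IH; have [_ _ ->] := step t.
  by apply: Xseg => //; rewrite (ltW beta_gt0).
have [k k0 Hk] := vi_sol_uniform_lipschitz f_smooth X_compact Xseg f_grad_lipschitz
  h_smooth h_convex slater_cond h_grad_lipschitz p_gt_Lf crcq.
have [C C0 HC] := primal_step_error A b f_smooth X_compact Xseg f_grad_lipschitz
  p_gt_Lf gamma_ge0 c_gt0.
have kR0 : 0 < k%:R :> R by rewrite ltr0n.
have C2 : 0 < C + 2 by rewrite ltr_wpDl.
(* The distance from [xyz] to [z t] is at most [C + 2] times delta: [C] for the step error from
   [xyz] to [x t], and one each for the legs to [x t.+1] and [z t]. This product equals the radius
   [k%:R^-1]. *)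
exists (k%:R * (C + 2))^-1, k%:R; split=> //; first by rewrite invr_gt0 mulr_gt0.
move=> t xyz; rewrite !ge_max => /andP[/andP[xx Axyz] zx].
have xyzK : is_argmin (constr_set h) (fun u => Kfun A b f gamma p u (z t) (y t.+1)) xyz.
  apply: argmin_is_argmin => //; first by exists x0s.
  exact: Kfun_continuous.
have [wvi Aw] := prox_argmin b p f_smooth X_compact Xseg (z t)
  (ex_intro2 (constr_set h) (fun v => A *m v = b) x0s x0X Ax0).
have dE : (k%:R * (C + 2))^-1 * (C + 2) = k%:R^-1.
  by rewrite invfM divfK// lt0r_neq0.
have d0 : 0 < (k%:R * (C + 2))^-1 by rewrite invr_gt0 mulr_gt0.
apply: (Hk (z t)) => //.
- have uvi := vi_sol_argmin_Kfun f_smooth Xseg xyzK.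
  exact uvi.
- have := HC (y t.+1) (z t) (x t) xyz (xX t) xyzK.
  have [_ <- _] := step t => H1.
  have H2 := ler_wpM2l C0 xx.
  rewrite -dE; move: H1 H2 xx zx (enorm_tri xyz (x t) (z t)) (enorm_tri (x t) (x t.+1) (z t)).
  rewrite (enormBC xyz (x t)) (enormBC (x t.+1) (z t)).
  by move: (_^-1) => d; gen_norms; lra.
rewrite -dE (le_trans Axyz)//; apply: ler_peMr; first exact: ltW.
by rewrite ler_wpDl// ler1n.
Qed.
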